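(* Let $f$ be a transcendental entire function. There exists $r(f)>0$ such that, whenever $r>0$ and $\alpha\in(0,1/2)$ satisfy $$\log M(r)\le r^{\alpha}\quad\text{and}\quad r^{1-2\alpha}\ge r(f),$$ there exists $t\in(r^{1-2\alpha},r)$ such that $$\log m(t)>\log M(r^{1-2\alpha})-2.$$
   Context: $M(r)=\max_{|z|=r}|f(z)|$ and $m(r)=\min_{|z|=r}|f(z)|$. *)

(* Defs.v *)
From Stdlib Require Import Reals ClassicalEpsilon.
Open Scope R_scope.

Definition Cpx := (R * R)%type.
Definition C0 : Cpx := (0, 0).
Definition C1 : Cpx := (1, 0).
Definition Cadd (z w : Cpx) : Cpx := (fst z + fst w, snd z + snd w).
Definition Csub (z w : Cpx) : Cpx := (fst z - fst w, snd z - snd w).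
Definition Cmul (z w : Cpx) : Cpx :=
  (fst z * fst w - snd z * snd w, fst z * snd w + snd z * fst w).
Fixpoint Cpow (z : Cpx) (n : nat) : Cpx :=
  match n with O => C1 | S k => Cmul z (Cpow z k) end.
Definition Cnorm (z : Cpx) : R := sqrt (fst z ^ 2 + snd z ^ 2).

Fixpoint psum (a : nat -> Cpx) (z : Cpx) (n : nat) : Cpx :=
  match n with
  | O => Cmul (a O) (Cpow z O)
  | S k => Cadd (psum a z k) (Cmul (a (S k)) (Cpow z (S k)))
  end.

Definition Clim (u : nat -> Cpx) (l : Cpx) : Prop :=
  forall eps, eps > 0 -> exists N, forall n, (n >= N)%nat -> Cnorm (Csub (u n) l) < eps.

Definition entire_series (a : nat -> Cpx) : Prop := forall z, exists l, Clim (psum a z) l.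

Definition series_fun (a : nat -> Cpx) (z : Cpx) : Cpx :=
  epsilon (inhabits C0) (fun l => Clim (psum a z) l).

(* transcendental = not a polynomial: infinitely many nonzero coefficients *)
Definition transcendental_series (a : nat -> Cpx) : Prop :=
  forall N, exists n, (n >= N)%nat /\ a n <> C0.

Definition is_max_mod (f : Cpx -> Cpx) (r v : R) : Prop :=
  (exists z, Cnorm z = r /\ Cnorm (f z) = v) /\ forall z, Cnorm z = r -> Cnorm (f z) <= v.
Definition is_min_mod (f : Cpx -> Cpx) (r v : R) : Prop :=
  (exists z, Cnorm z = r /\ Cnorm (f z) = v) /\ forall z, Cnorm z = r -> v <= Cnorm (f z).

Definition max_mod (f : Cpx -> Cpx) (r : R) : R := epsilon (inhabits 0) (is_max_mod f r).
Definition min_mod (f : Cpx -> Cpx) (r : R) : R := epsilon (inhabits 0) (is_min_mod f r).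

(* Main.v *)
(** Beurling's estimate for a function that is small somewhere on every circle
    [|z| = t], [r1 < t < R], where [r1 = r^(1-2 alpha)], [R = r] and "small" means
    at most [mu = M(r1) e^-2].  After approximation by Taylor polynomials and scaling
    to the unit disc, [f] is a locally uniform limit of finite Blaschke products
    (up to the factor [M(R)]).  Replacing each zero [a] of such a product by [|a|]
    decreases the modulus at [|z|] below its value at [z] and increases it at [-|z|], so the new
    product is small on the whole slit [[rho, 1]], [rho = r1/R], and dominates the old one
    at [-rho].  The slit disc is the image of a half disc, where the maximum principle with
    an explicit polynomial barrier gives [ln (M(r1)/mu) <= 2 sqrt(r1/R) ln (M(R)/mu)].
    Since [sqrt(r1/R) = r^-alpha] and [ln M(R) <= r^alpha], this is impossible once
    [ln M(r1) > 2]. *)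

Require Import Defs.
From Stdlib Require Import Reals Lra Lia Psatz Classical ClassicalEpsilon List.
From Coquelicot Require Import Coquelicot.
From mathcomp Require all_boot all_algebra complex Rstruct.
Open Scope R_scope.

(** * Second-order expansions and the maximum principle *)

(** Moving zeros works factor by factor on a Blaschke product, because with [|z|] and [|a|] fixed
    the modulus of a factor is monotone in the cosine of the angle between [z] and [a]. A bounded
    holomorphic function also has a zero-free part, to which this does not apply, and a normalized
    Taylor polynomial [g] of degree at most [n] has modulus below 1 on the unit circle. Adding [z^N]
    with [N > n] and dividing by the reversed polynomial makes the modulus 1 on the circle and
    leaves only Blaschke factors, while inside the disc numerator and denominator move by at most
    [|z|^(N - n)]. This is useless near the circle, so the estimates are made in a disc of radius
    [1 - x] with error [x], and [x] tends to 0 at the end. The factor 2 in the estimate leaves room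
    for an approximate barrier: the harmonic measure of the semicircle in the half disc is
    [(4/pi) arctan s] on the real axis, and [s] is about [sqrt (2 rho)] at the relevant point, so
    the sharp leading constant is about 1.80. A polynomial with slope 1.41 at the origin therefore
    suffices. *)

Definition near0 (P : C -> Prop) : Prop :=
  exists d, 0 < d /\ forall h, Cmod h < d -> P h.

Lemma near0_and (P Q : C -> Prop) :
  near0 P -> near0 Q -> near0 (fun h => P h /\ Q h).
Proof.
intros [d [Hd HP]] [e [He HQ]].
exists (Rmin d e); split; [now apply Rmin_glb_lt|].
intros h Hh; split; [apply HP | apply HQ];
  eapply Rlt_le_trans; eauto; [apply Rmin_l | apply Rmin_r].
Qed.

Lemma near0_imp (P Q : C -> Prop) :
  (forall h, P h -> Q h) -> near0 P -> near0 Q.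
Proof. intros H [d [Hd HP]]; exists d; split; auto. Qed.

Lemma near0_true (P : C -> Prop) : (forall h, P h) -> near0 P.
Proof. intros H; exists 1; split; [lra | auto]. Qed.

Definition bdd (r : C -> C) : Prop := exists K, near0 (fun h => Cmod (r h) <= K).

Lemma bdd_const (c : C) : bdd (fun _ => c).
Proof. exists (Cmod c); apply near0_true; intros; lra. Qed.

Lemma bdd_id : bdd (fun h => h).
Proof. exists 1, 1; split; [lra | intros; lra]. Qed.

Lemma bdd_plus (u v : C -> C) : bdd u -> bdd v -> bdd (fun h => (u h + v h)%C).
Proof.
intros [K HK] [L HL]; exists (K + L).
eapply near0_imp; [|exact (near0_and _ _ HK HL)]; cbv beta; intros h [H1 H2].
pose proof (Cmod_triangle (u h) (v h)); lra.
Qed.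

Lemma bdd_mult (u v : C -> C) : bdd u -> bdd v -> bdd (fun h => (u h * v h)%C).
Proof.
intros [K HK] [L HL]; exists (K * L).
eapply near0_imp; [|exact (near0_and _ _ HK HL)]; cbv beta; intros h [H1 H2].
rewrite Cmod_mult; apply Rmult_le_compat; auto using Cmod_ge_0.
Qed.

(* Second-order Taylor expansion with a remainder O(h^3); it replaces holomorphy. *)
Definition jet2 (A : C -> C) (s : C) : Prop :=
  exists (c1 c2 : C) (r : C -> C), bdd r /\
    near0 (fun h => A (s + h)%C = (A s + c1 * h + c2 * (h * h) + h * h * h * r h)%C).

Lemma jet2_const (c s : C) : jet2 (fun _ => c) s.
Proof.
exists 0%C, 0%C, (fun _ => 0%C); split; [apply bdd_const|].
apply near0_true; intros h; ring.
Qed.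

Lemma jet2_id (s : C) : jet2 (fun z => z) s.
Proof.
exists 1%C, 0%C, (fun _ => 0%C); split; [apply bdd_const|].
apply near0_true; intros h; ring.
Qed.

Lemma jet2_plus (A B : C -> C) (s : C) :
  jet2 A s -> jet2 B s -> jet2 (fun z => (A z + B z)%C) s.
Proof.
intros (a1 & a2 & r & Hr & HA) (b1 & b2 & q & Hq & HB).
exists (a1 + b1)%C, (a2 + b2)%C, (fun h => (r h + q h)%C); split; [now apply bdd_plus|].
eapply near0_imp; [|exact (near0_and _ _ HA HB)]; cbv beta; intros h [-> ->]; ring.
Qed.

Lemma jet2_mult (A B : C -> C) (s : C) :
  jet2 A s -> jet2 B s -> jet2 (fun z => (A z * B z)%C) s.
Proof.
intros (a1 & a2 & r & Hr & HA) (b1 & b2 & q & Hq & HB).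
exists (A s * b1 + a1 * B s)%C, (A s * b2 + a1 * b1 + a2 * B s)%C,
  (fun h => (a1 * b2 + a2 * b1 + a2 * b2 * h
    + r h * (B s + b1 * h + b2 * (h * h) + h * h * h * q h)
    + q h * (A s + a1 * h + a2 * (h * h)))%C); split.
- repeat first [apply bdd_plus | apply bdd_mult | apply bdd_const | apply bdd_id | assumption].
- eapply near0_imp; [|exact (near0_and _ _ HA HB)]; cbv beta; intros h [-> ->]; ring.
Qed.

Lemma jet2_pow (A : C -> C) (n : nat) (s : C) :
  jet2 A s -> jet2 (fun z => (A z ^ n)%C) s.
Proof.
intros HA; induction n as [|n IH]; simpl; [apply jet2_const | now apply jet2_mult].
Qed.

(** In a composition the inner increment has the form [h * u h] with [u] bounded, so a neighbourhood
    for the outer expansion pulls back. The [+ 1] keeps the divisor positive when [K] is 0. *)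
Lemma near0_small (u : C -> C) (P : C -> Prop) :
  bdd u -> near0 P -> near0 (fun h => P (h * u h)%C).
Proof.
intros [K [d [Hd HK]]] [e [He HP]].
exists (Rmin d (e / (Rabs K + 1))); split.
- apply Rmin_glb_lt; [lra|]. apply Rdiv_lt_0_compat; [lra|]. pose proof (Rabs_pos K); lra.
- intros h Hh; apply HP; rewrite Cmod_mult.
  assert (H1 : Cmod (u h) <= K) by (apply HK; eapply Rlt_le_trans; [exact Hh | apply Rmin_l]).
  assert (H2 : Cmod h < e / (Rabs K + 1)) by (eapply Rlt_le_trans; [exact Hh | apply Rmin_r]).
  pose proof (Rabs_pos K); pose proof (Rle_abs K).
  pose proof (Cmod_ge_0 h); pose proof (Cmod_ge_0 (u h)).
  apply Rlt_div_r in H2; [|lra]. nra.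
Qed.

Lemma jet2_comp (F G : C -> C) (s : C) :
  jet2 F (G s) -> jet2 G s -> jet2 (fun z => F (G z)) s.
Proof.
intros (d1 & d2 & q & [K Hq] & HF) (c1 & c2 & r & Hr & HG).
pose (n := fun h => (c2 + h * r h)%C).
pose (m := fun h => (c1 + h * n h)%C).
assert (Hn : bdd n) by
  (repeat first [apply bdd_plus | apply bdd_mult | apply bdd_const | apply bdd_id | assumption]).
assert (Hm : bdd m) by
  (repeat first [apply bdd_plus | apply bdd_mult | apply bdd_const | apply bdd_id | assumption]).
exists (d1 * c1)%C, (d1 * c2 + d2 * (c1 * c1))%C,
  (fun h => (d1 * r h + d2 * (2 * c1 * n h + h * (n h * n h)) + m h * m h * m h * q (h * m h))%C).
split.
- assert (bdd (fun h => q (h * m h)%C)) by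
    (exists K; exact (near0_small m (fun k => Cmod (q k) <= K) Hm Hq)).
  repeat first [assumption | apply bdd_plus | apply bdd_mult | apply bdd_const | apply bdd_id].
- pose proof (near0_small m _ Hm HF) as HF'.
  eapply near0_imp; [|exact (near0_and _ _ HG HF')]; cbv beta; intros h [-> H].
  replace (G s + c1 * h + c2 * (h * h) + h * h * h * r h)%C with (G s + h * m h)%C
    by (unfold m, n; ring).
  rewrite H; unfold m, n; ring.
Qed.

Lemma jet2_inv (s : C) : s <> 0%C -> jet2 Cinv s.
Proof.
intros Hs.
assert (H0 : 0 < Cmod s) by now apply Cmod_gt_0.
assert (Hnz : near0 (fun h => Cmod s / 2 <= Cmod (s + h)%C)).
{ exists (Cmod s / 2); split; [lra|]; intros h Hh.
  pose proof (Cmod_triangle (s + h) (- h)) as H; rewrite Cmod_opp in H.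
  replace (s + h + - h)%C with s in H by ring; lra. }
(* Geometric series stopped after [h^2]; the exact remainder is [- h^3 / (s^3 (s + h))]. *)
exists (- / (s * s))%C, (/ (s * s * s))%C, (fun h => (- (/ (s * s * s)) * / (s + h))%C); split.
- apply bdd_mult; [apply bdd_const|].
  exists (/ (Cmod s / 2)).
  eapply near0_imp; [|exact Hnz]; cbv beta; intros h Hh.
  rewrite Cmod_inv; [apply Rinv_le_contravar; lra|].
  apply Cmod_gt_0; lra.
- eapply near0_imp; [|exact Hnz]; cbv beta; intros h Hh.
  assert ((s + h)%C <> 0%C) by (apply Cmod_gt_0; lra).
  now field.
Qed.

(** * Taylor remainders of the exponential, sine and cosine *)

Lemma mvt_power_bound (f df : R -> R) (K : R) (n : nat) :
  f 0 = 0 -> (forall t, is_derive f t (df t)) ->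
  (forall t, Rabs t <= 1 -> Rabs (df t) <= K * Rabs t ^ n) ->
  forall x, Rabs x <= 1 -> Rabs (f x) <= K * Rabs x ^ S n.
Proof.
intros H0 Hd HK x Hx.
destruct (MVT_gen f 0 x df) as [c [Hc E]].
- intros; apply Hd.
- intros t _; apply continuity_pt_filterlim, (ex_derive_continuous f t); exists (df t); apply Hd.
- rewrite H0, !Rminus_0_r in E; rewrite E, Rabs_mult.
  assert (Hcx : Rabs c <= Rabs x).
  { revert Hc; unfold Rmin, Rmax; destruct (Rle_dec 0 x); intros Hc;
      unfold Rabs; repeat destruct Rcase_abs; lra. }
  assert (Hc1 : Rabs (df c) <= K * Rabs c ^ n) by (apply HK; lra).
  assert (HK0 : 0 <= K).
  { specialize (HK 1); rewrite Rabs_R1, pow1, Rmult_1_r in HK.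
    eapply Rle_trans; [apply Rabs_pos | apply HK; lra]. }
  assert (Hp : Rabs c ^ n <= Rabs x ^ n) by (apply pow_incr; split; [apply Rabs_pos | lra]).
  simpl. pose proof (Rabs_pos x).
  replace (K * (Rabs x * Rabs x ^ n)) with ((K * Rabs x ^ n) * Rabs x) by ring.
  apply Rmult_le_compat_r; [lra|].
  apply Rle_trans with (1 := Hc1). now apply Rmult_le_compat_l.
Qed.

Lemma exp_taylor2 (x : R) : Rabs x <= 1 -> Rabs (exp x - 1 - x - x ^ 2 / 2) <= 3 * Rabs x ^ 3.
Proof.
revert x.
(* The derivative of a Taylor remainder is the remainder of one order less, so three uses of the
   mean value bound reduce the claim to [exp t <= 3]; the constant is the same at each stage. *)
apply (mvt_power_bound _ (fun x => exp x - 1 - x)).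
{ rewrite exp_0; lra. }
{ intros t; auto_derive; auto; field. }
apply (mvt_power_bound _ (fun x => exp x - 1)).
{ rewrite exp_0; lra. }
{ intros t; auto_derive; auto; field. }
apply (mvt_power_bound _ exp).
{ rewrite exp_0; lra. }
{ intros t; auto_derive; auto; field. }
intros t Ht; simpl; rewrite Rabs_pos_eq by apply Rlt_le, exp_pos.
rewrite Rmult_1_r.
apply Rle_trans with (exp 1); [|apply exp_le_3].
pose proof (Rle_abs t).
destruct (Req_dec t 1) as [-> | H1]; [lra | apply Rlt_le, exp_increasing; lra].
Qed.

Lemma sin_bound1 (x : R) : Rabs x <= 1 -> Rabs (sin x) <= 1 * Rabs x ^ 1.
Proof.
revert x; apply (mvt_power_bound _ cos).
{ apply sin_0. }
{ intros t; auto_derive; auto; ring. }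
intros t _; simpl; pose proof (COS_bound t); apply Rabs_le; lra.
Qed.

Lemma sin_taylor2 (x : R) : Rabs x <= 1 -> Rabs (sin x - x) <= 1 * Rabs x ^ 3.
Proof.
revert x; apply (mvt_power_bound _ (fun x => cos x - 1)).
{ rewrite sin_0; ring. }
{ intros t; auto_derive; auto; ring. }
apply (mvt_power_bound _ (fun x => - sin x)).
{ rewrite cos_0; ring. }
{ intros t; auto_derive; auto; ring. }
intros t Ht; rewrite Rabs_Ropp; now apply sin_bound1.
Qed.

Lemma cos_taylor2 (x : R) : Rabs x <= 1 -> Rabs (cos x - 1 + x ^ 2 / 2) <= 1 * Rabs x ^ 4.
Proof.
revert x; apply (mvt_power_bound _ (fun x => - (sin x - x))).
{ rewrite cos_0; field. }
{ intros t; auto_derive; auto; field. }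
intros t Ht; rewrite Rabs_Ropp; now apply sin_taylor2.
Qed.

Definition Cexp (z : C) : C := (exp (fst z) * cos (snd z), exp (fst z) * sin (snd z)).

Lemma Cexp_plus (z w : C) : Cexp (z + w) = (Cexp z * Cexp w)%C.
Proof.
unfold Cexp, Cmult; simpl; rewrite exp_plus, cos_plus, sin_plus; f_equal; ring.
Qed.

Lemma Cmod_Cexp (z : C) : Cmod (Cexp z) = exp (fst z).
Proof.
unfold Cmod, Cexp; simpl fst; simpl snd.
replace ((exp (fst z) * cos (snd z)) ^ 2 + (exp (fst z) * sin (snd z)) ^ 2)
  with (exp (fst z) ^ 2 * (Rsqr (sin (snd z)) + Rsqr (cos (snd z)))) by (unfold Rsqr; ring).
rewrite sin2_cos2, Rmult_1_r; apply sqrt_pow2, Rlt_le, exp_pos.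
Qed.

Lemma Cmod_le_sum (x y : R) : Cmod (x, y) <= Rabs x + Rabs y.
Proof.
replace (x, y) with (x + Ci * y)%C
  by (unfold Ci, RtoC, Cplus, Cmult; simpl; f_equal; ring).
eapply Rle_trans; [apply Cmod_triangle|].
rewrite Cmod_mult, Cmod_Ci, !Cmod_R; lra.
Qed.

Lemma Cexp_taylor2 (h : C) : Cmod h <= 1 ->
  Cmod (Cexp h - 1 - h - / 2 * (h * h)) <= 30 * Cmod h ^ 3.
Proof.
intros Hh; destruct h as [x y].
pose proof (Rmax_Cmod (x, y)) as Hm; cbn [fst snd] in Hm.
pose proof (Rmax_l (Rabs x) (Rabs y)); pose proof (Rmax_r (Rabs x) (Rabs y)).
set (c := Cmod (x, y)) in *.
pose proof (exp_taylor2 x ltac:(lra)) as H1.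
pose proof (sin_taylor2 y ltac:(lra)) as H2.
pose proof (cos_taylor2 y ltac:(lra)) as H3.
set (e1 := exp x - 1 - x - x ^ 2 / 2) in *.
set (e2 := sin y - y) in *.
set (e3 := cos y - 1 + y ^ 2 / 2) in *.
assert (Ee : exp x = 1 + x + x ^ 2 / 2 + e1) by (unfold e1; ring).
assert (Es : sin y = y + e2) by (unfold e2; ring).
assert (Ec : cos y = 1 - y ^ 2 / 2 + e3) by (unfold e3; ring).
assert (Hc : 0 <= c) by apply Cmod_ge_0.
assert (Hx := Rabs_pos x); assert (Hy := Rabs_pos y).
assert (P3 : forall a, 0 <= a <= c -> a ^ 3 <= c ^ 3) by (intros; now apply pow_incr).
assert (H1' : Rabs e1 <= 3 * c ^ 3) by (pose proof (P3 (Rabs x) ltac:(lra)); lra).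
assert (H2' : Rabs e2 <= c ^ 3) by (pose proof (P3 (Rabs y) ltac:(lra)); lra).
assert (H3' : Rabs e3 <= c ^ 3).
{ pose proof (P3 (Rabs y) ltac:(lra)).
  assert (Rabs y ^ 4 <= Rabs y ^ 3); [|lra].
  replace (Rabs y ^ 4) with (Rabs y ^ 3 * Rabs y) by ring.
  assert (0 <= Rabs y ^ 3) by (apply pow_le; lra). nra. }
assert (Hcb : Rabs (cos y) <= 1) by (pose proof (COS_bound y); apply Rabs_le; lra).
assert (Hsb : Rabs (sin y) <= 1) by (pose proof (SIN_bound y); apply Rabs_le; lra).
assert (Hq : Rabs (1 + x + x ^ 2 / 2) <= 5 / 2).
{ assert (Hx1 : Rabs x <= 1) by lra. apply Rabs_le_between in Hx1. apply Rabs_le; nra. }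
assert (Hxyy : Rabs (x * y ^ 2) <= c ^ 3).
{ rewrite Rabs_mult, <- RPow_abs.
  replace (c ^ 3) with (c * c ^ 2) by ring.
  apply Rmult_le_compat; auto; [apply pow_le; lra | lra | apply pow_incr; lra]. }
assert (Hxxy : Rabs (x ^ 2 * y) <= c ^ 3).
{ rewrite Rabs_mult, <- RPow_abs.
  replace (c ^ 3) with (c ^ 2 * c) by ring.
  apply Rmult_le_compat; auto; [apply pow_le; lra | apply pow_incr; lra | lra]. }
assert (Hxx : Rabs (x * (x * y ^ 2)) <= c ^ 3).
{ rewrite Rabs_mult. assert (0 <= c ^ 3) by (now apply pow_le).
  pose proof (Rabs_pos (x * y ^ 2)); nra. }
(* Each coordinate is a sum of monomials of degree at least 3 and products containing one of [e1],
   [e2], [e3]. The total is at most [6.25 c^3] per coordinate, so 30 is generous. *)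
replace (Cexp (x, y) - 1 - (x, y) - / 2 * ((x, y) * (x, y)))%C with
  (- (x * y ^ 2) / 2 - (x * (x * y ^ 2)) / 4 + (1 + x + x ^ 2 / 2) * e3 + e1 * cos y,
   (x ^ 2 * y) / 2 + (1 + x + x ^ 2 / 2) * e2 + e1 * sin y).
2:{ unfold Cexp, Cmult, Cminus, Cplus, Copp, Cinv, RtoC; simpl fst; simpl snd.
    rewrite Ee, Es, Ec; f_equal; field. }
eapply Rle_trans; [apply Cmod_le_sum|].
assert (T1 : Rabs ((1 + x + x ^ 2 / 2) * e3) <= 5 / 2 * c ^ 3)
  by (rewrite Rabs_mult; apply Rmult_le_compat; auto using Rabs_pos).
assert (T2 : Rabs ((1 + x + x ^ 2 / 2) * e2) <= 5 / 2 * c ^ 3)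
  by (rewrite Rabs_mult; apply Rmult_le_compat; auto using Rabs_pos).
assert (T3 : Rabs (e1 * cos y) <= 3 * c ^ 3 * 1)
  by (rewrite Rabs_mult; apply Rmult_le_compat; auto using Rabs_pos).
assert (T4 : Rabs (e1 * sin y) <= 3 * c ^ 3 * 1)
  by (rewrite Rabs_mult; apply Rmult_le_compat; auto using Rabs_pos).
assert (Hc3 : 0 <= c ^ 3) by now apply pow_le.
apply Rabs_le_between in T1, T2, T3, T4, Hxyy, Hxxy, Hxx.
replace (30 * c ^ 3) with (15 * c ^ 3 + 15 * c ^ 3) by ring.
apply Rplus_le_compat; apply Rabs_le; lra.
Qed.

Lemma jet2_Cexp (s : C) : jet2 Cexp s.
Proof.
pose (r := fun h => (Cexp s * ((Cexp h - 1 - h - / 2 * (h * h)) * / (h * h * h)))%C).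
exists (Cexp s), (Cexp s * / 2)%C, r; split.
- apply bdd_mult; [apply bdd_const|].
  exists 30, 1; split; [lra|]; intros h Hh.
  destruct (classic (h = 0%C)) as [-> | Hn].
  + replace (Cexp 0 - 1 - 0 - / 2 * (0 * 0))%C with (RtoC 0);
      [rewrite Cmod_mult, Cmod_0; lra|].
    unfold Cexp, RtoC, Cmult, Cminus, Cplus, Copp; simpl.
    rewrite exp_0, cos_0, sin_0; f_equal; ring.
  + assert (0 < Cmod h) by now apply Cmod_gt_0.
    rewrite Cmod_mult, Cmod_inv, !Cmod_mult by (now repeat apply Cmult_neq_0).
    apply Rle_div_l; [repeat apply Rmult_lt_0_compat; lra|].
    pose proof (Cexp_taylor2 h ltac:(lra)); simpl in *; lra.
- apply near0_true; intros h; rewrite Cexp_plus; unfold r.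
  destruct (classic (h = 0%C)) as [-> | Hn].
  + assert (E : Cexp 0 = RtoC 1)
      by (unfold Cexp, RtoC; simpl; rewrite exp_0, cos_0, sin_0; f_equal; ring).
    rewrite E; ring.
  + now field.
Qed.

(* Averaging over the four points [s + i^k t] cancels the terms in [h] and [h^2]
   of [|A|^2], so [|A|^2 + eps |z|^2] has a strict submean property. *)
Lemma no_interior_max (A : C -> C) (s : C) (eps : R) : 0 < eps -> jet2 A s ->
  ~ near0 (fun h => Cmod (A (s + h)%C) ^ 2 + eps * Cmod (s + h)%C ^ 2
                    <= Cmod (A s) ^ 2 + eps * Cmod s ^ 2).
Proof.
intros He (c1 & c2 & r & [K HK] & HA) Hmax.
destruct (near0_and _ _ Hmax (near0_and _ _ HK HA)) as [d [Hd H]].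
pose (M := Cmod (A s) + Cmod c1 + Cmod c2).
assert (HM : 0 <= M)
  by (unfold M; pose proof (Cmod_ge_0 (A s)); pose proof (Cmod_ge_0 c1);
      pose proof (Cmod_ge_0 c2); lra).
(* Dropping the cubic remainder costs at most [2 M |K| t^3] in [|A|^2], whereas [eps |z|^2] gains
   [eps t^2] on average. A radius with [t * L <= eps] makes the gain strictly larger. *)
pose (L := 2 * M * Rabs K + 1).
assert (HL : 0 < L) by (unfold L; pose proof (Rabs_pos K); nra).
pose (t := Rmin (Rmin (d / 2) 1) (eps / L)).
assert (Ht0 : 0 < t).
{ unfold t; repeat apply Rmin_glb_lt; try lra; now apply Rdiv_lt_0_compat. }
assert (Htd : t <= d / 2) by (unfold t; eapply Rle_trans; [apply Rmin_l | apply Rmin_l]).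
assert (Ht1 : t <= 1) by (unfold t; eapply Rle_trans; [apply Rmin_l | apply Rmin_r]).
assert (HtL : t * L <= eps) by (apply Rle_div_r; [lra | apply Rmin_r]).
assert (step : forall h, Cmod h = t ->
  Cmod (A s + c1 * h + c2 * (h * h))%C ^ 2 - 2 * M * Rabs K * t ^ 3
    + eps * Cmod (s + h)%C ^ 2 <= Cmod (A s) ^ 2 + eps * Cmod s ^ 2).
{ intros h Hh; destruct (H h ltac:(lra)) as (H1 & H2 & H3).
  eapply Rle_trans; [|exact H1]; apply Rplus_le_compat_r; rewrite H3.
  set (X := (A s + c1 * h + c2 * (h * h))%C).
  set (E := (h * h * h * r h)%C).
  assert (HX : Cmod X <= M).
  { unfold X; eapply Rle_trans; [apply Cmod_triangle|].
    pose proof (Cmod_triangle (A s) (c1 * h)).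
    rewrite !Cmod_mult, Hh in *. unfold M.
    pose proof (Cmod_ge_0 c1); pose proof (Cmod_ge_0 c2).
    assert (Cmod c1 * t <= Cmod c1) by nra.
    assert (t * t <= 1) by nra.
    assert (Cmod c2 * (t * t) <= Cmod c2) by nra. lra. }
  assert (HE : Cmod E <= Rabs K * t ^ 3).
  { unfold E; rewrite !Cmod_mult, Hh.
    replace (Rabs K * t ^ 3) with (t * t * t * Rabs K) by ring.
    apply Rmult_le_compat_l; [assert (0 < t * t) by nra; nra|].
    pose proof (Rle_abs K); lra. }
  assert (HT : Cmod X <= Cmod (X + E) + Cmod E).
  { pose proof (Cmod_triangle (X + E) (- E)) as T; rewrite Cmod_opp in T.
    replace (X + E + - E)%C with X in T by ring; exact T. }
  pose proof (Cmod_ge_0 X); pose proof (Cmod_ge_0 E); pose proof (Cmod_ge_0 (X + E)).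
  replace (2 * M * Rabs K * t ^ 3) with (2 * (M * (Rabs K * t ^ 3))) by ring.
  assert (Cmod X * Cmod E <= M * (Rabs K * t ^ 3)) by (apply Rmult_le_compat; auto).
  assert (Cmod X ^ 2 - 2 * (Cmod X * Cmod E) <= Cmod (X + E) ^ 2); [|lra].
  destruct (Rle_dec (Cmod X) (Cmod E)); [nra|].
  assert ((Cmod X - Cmod E) ^ 2 <= Cmod (X + E) ^ 2) by (apply pow_incr; lra).
  nra. }
assert (Hr : Cmod (RtoC t) = t) by (rewrite Cmod_R; apply Rabs_pos_eq; lra).
assert (Hi : Cmod (Ci * t)%C = t) by (rewrite Cmod_mult, Cmod_Ci, Hr; ring).
pose proof (step (RtoC t) Hr) as S1.
pose proof (step (- RtoC t)%C ltac:(now rewrite Cmod_opp)) as S2.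
pose proof (step (Ci * t)%C Hi) as S3.
pose proof (step (- (Ci * t))%C ltac:(now rewrite Cmod_opp)) as S4.
assert (Hsmall : 2 * M * Rabs K * t ^ 3 < eps * t ^ 2).
{ replace (2 * M * Rabs K * t ^ 3) with ((2 * M * Rabs K * t) * t ^ 2) by ring.
  apply Rmult_lt_compat_r; [nra|]. unfold L in HtL; nra. }
rewrite !Cmod2_alt in S1, S2, S3, S4.
clear - S1 S2 S3 S4 Hsmall.
destruct (A s) as [a a'], c1 as [b b'], c2 as [c c'], s as [x y].
unfold Re, Im, RtoC, Ci, Cmult, Cplus, Copp in S1, S2, S3, S4; simpl fst in *; simpl snd in *.
set (E := 2 * M * Rabs K * t ^ 3) in *; clearbody E.
assert (0 <= (b * t) ^ 2) by apply pow2_ge_0.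
assert (0 <= (b' * t) ^ 2) by apply pow2_ge_0.
assert (0 <= (c * t ^ 2) ^ 2) by apply pow2_ge_0.
assert (0 <= (c' * t ^ 2) ^ 2) by apply pow2_ge_0.
lra.
Qed.

(** * Compactness in the plane and the maximum principle *)

Lemma box_lebesgue (V : C -> R -> Prop) (B : R) :
  (forall q d e, 0 < d <= e -> V q e -> V q d) ->
  (forall p, exists e, 0 < e /\ forall h, Cmod h < e -> V (p + h)%C e) ->
  exists d, 0 < d /\ forall q, Cmod q <= B -> V q d.
Proof.
intros Hmono Hloc.
(* The factor 2 passes from the squares used by [compactness_value_2d] to discs:
   [Cmod (x, y) <= |x| + |y|]. *)
assert (Hc : forall p : C, exists e : posreal, forall h, Cmod h < 2 * e -> V (p + h)%C e).
{ intros p; destruct (Hloc p) as (e & He & H).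
  exists (mkposreal (e / 2) ltac:(lra)); simpl; intros h Hh.
  apply (Hmono _ _ e); [lra|]; apply H; lra. }
pose (delta := fun u v : R => proj1_sig (constructive_indefinite_description _ (Hc (u, v)))).
assert (Hdelta : forall u v h, Cmod h < 2 * delta u v -> V ((u, v) + h)%C (delta u v))
  by (intros u v; exact (proj2_sig (constructive_indefinite_description _ (Hc (u, v))))).
destruct (compactness_value_2d (- B) B (- B) B delta) as [d Hd].
exists d; split; [apply cond_pos|]; intros [x y] Hq.
pose proof (Rmax_Cmod (x, y)) as Hm; cbn [fst snd] in Hm.
pose proof (Rmax_l (Rabs x) (Rabs y)); pose proof (Rmax_r (Rabs x) (Rabs y)).
assert (Hx : Rabs x <= B) by lra; assert (Hy : Rabs y <= B) by lra.
apply Rabs_le_between in Hx; apply Rabs_le_between in Hy.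
apply NNPP; intros HN; apply (Hd x y Hx Hy); intros (u & v & _ & _ & H1 & H2 & H3).
apply HN, (Hmono _ _ (delta u v)); [split; [apply cond_pos | exact H3]|].
replace (x, y) with (Cplus (u, v) (x - u, y - v))
  by (unfold Cplus; simpl; f_equal; ring).
apply Hdelta; eapply Rle_lt_trans; [apply Cmod_le_sum|]; lra.
Qed.

Definition near_in (S : C -> Prop) (p : C) (P : C -> Prop) : Prop :=
  near0 (fun h => S (p + h)%C -> P (p + h)%C).

(** The last hypothesis is upper semicontinuity. One uniform scale [d] is extracted twice: with
    [u q <= / e] it gives boundedness, and with [u q <= s - e] it would lower the supremum [s] if
    [s] were not attained. *)
Lemma attains_max (S : C -> Prop) (u : C -> R) (B : R) :
  (exists p, S p) -> (forall p, S p -> Cmod p <= B) ->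
  (forall p, ~ S p -> near0 (fun h => ~ S (p + h)%C)) ->
  (forall p, S p -> forall e, 0 < e -> near_in S p (fun q => u q < u p + e)) ->
  exists p, S p /\ forall q, S q -> u q <= u p.
Proof.
intros [p0 Hp0] HB Hcl Hu.
assert (Hglob : forall V : R -> R -> Prop,
  (forall x d e, 0 < d <= e -> V x e -> V x d) ->
  (forall p, S p -> exists e, 0 < e /\ near_in S p (fun q => V (u q) e)) ->
  exists d, 0 < d /\ forall q, S q -> V (u q) d).
{ intros V Hm Hl.
  destruct (box_lebesgue (fun q e => S q -> V (u q) e) B) as (d & Hd & H).
  - intros q d e Hde H1 H2; eapply Hm; eauto.
  - intros p; destruct (classic (S p)) as [Hp | Hp].
    + destruct (Hl p Hp) as (e & He & e' & He' & H).
      exists (Rmin e e'); split; [now apply Rmin_glb_lt|].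
      intros h Hh HS; apply (Hm _ _ e); [split; [now apply Rmin_glb_lt | apply Rmin_l]|].
      apply H; auto; eapply Rlt_le_trans; [exact Hh | apply Rmin_r].
    + destruct (Hcl p Hp) as (e & He & H); exists e; split; auto.
      intros h Hh HS; exfalso; exact (H h Hh HS).
  - exists d; split; auto. }
assert (Hbd : exists m, forall q, S q -> u q <= m).
{ destruct (Hglob (fun x e => x <= / e)) as (d & Hd & H).
  - intros x d e Hde Hx; apply Rle_trans with (1 := Hx), Rinv_le_contravar; lra.
  - intros p Hp; exists (/ (Rabs (u p) + 1)).
    pose proof (Rabs_pos (u p)); pose proof (Rle_abs (u p)).
    split; [apply Rinv_0_lt_compat; lra|].
    eapply near0_imp; [|exact (Hu p Hp 1 Rlt_0_1)]; cbv beta; intros h Hh HS.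
    rewrite Rinv_inv; specialize (Hh HS); lra.
  - exists (/ d); exact H. }
destruct Hbd as [m Hm].
destruct (completeness (fun x => exists q, S q /\ x = u q)) as [s [Hs1 Hs2]].
- exists m; intros x [q [Hq ->]]; auto.
- exists (u p0), p0; auto.
- destruct (classic (exists p, S p /\ u p = s)) as [[p [Hp E]] | HN].
  + exists p; split; auto; intros q Hq; rewrite E; apply Hs1; now exists q.
  + exfalso.
    assert (Hlt : forall p, S p -> u p < s).
    { intros p Hp; destruct (Hs1 (u p)) as [|E]; [now exists p | lra |].
      exfalso; apply HN; now exists p. }
    destruct (Hglob (fun x e => x <= s - e)) as (d & Hd & H).
    * intros x d e Hde Hx; lra.
    * intros p Hp; exists ((s - u p) / 2); specialize (Hlt p Hp); split; [lra|].
      eapply near0_imp; [|exact (Hu p Hp ((s - u p) / 2) ltac:(lra))].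
      cbv beta; intros h Hh HS; specialize (Hh HS); lra.
    * assert (s <= s - d); [|lra].
      apply Hs2; intros x [q [Hq ->]]; auto.
Qed.

Lemma jet2_near (A : C -> C) (s : C) (e : R) : jet2 A s -> 0 < e ->
  near0 (fun h => Cmod (A (s + h)%C - A s) < e).
Proof.
intros (c1 & c2 & r & Hr & HA) He.
assert (Hb : bdd (fun h => c1 + c2 * h + h * h * r h)%C)
  by (repeat first [assumption | apply bdd_plus | apply bdd_mult | apply bdd_const | apply bdd_id]).
assert (He' : near0 (fun h => Cmod h < e)) by (exists e; auto).
eapply near0_imp; [|exact (near0_and _ _ HA (near0_small _ _ Hb He'))].
cbv beta; intros h [-> H].
replace (A s + c1 * h + c2 * (h * h) + h * h * h * r h - A s)%C
  with (h * (c1 + c2 * h + h * h * r h))%C by ring; exact H.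
Qed.

Lemma Cmod_minus_bound (z w : C) : Cmod z <= Cmod w + Cmod (z - w).
Proof.
replace z with (w + (z - w))%C at 1 by ring; apply Cmod_triangle.
Qed.

(** The perturbed function [|A|^2 + e |z|^2] attains its maximum on the compact set [S], and
    [no_interior_max] forces the maximum point into [bd]. Since [|z| <= B], the choice of [e] makes
    the perturbation cost at most [eps], which is arbitrary. *)
Theorem maximum_principle (S bd : C -> Prop) (A : C -> C) (B m : R) :
  (forall p, S p -> Cmod p <= B) ->
  (forall p, ~ S p -> near0 (fun h => ~ S (p + h)%C)) ->
  (forall p, S p -> ~ bd p -> near0 (fun h => S (p + h)%C)) ->
  (forall p, S p -> jet2 A p) ->
  0 <= m -> (forall p, bd p -> Cmod (A p) <= m) ->
  forall p, S p -> Cmod (A p) <= m.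
Proof.
intros HB Hcl Hint HA Hm Hbd p Hp.
assert (key : forall eps, 0 < eps -> Cmod (A p) ^ 2 <= m ^ 2 + eps).
{ intros eps Heps.
  pose (e := eps / (B ^ 2 + 1)).
  assert (HB2 : 0 < B ^ 2 + 1) by (pose proof (pow2_ge_0 B); lra).
  assert (He : 0 < e) by (apply Rdiv_lt_0_compat; lra).
  destruct (attains_max S (fun q => Cmod (A q) ^ 2 + e * Cmod q ^ 2) B) as (q & Hq & Hmax); auto.
  - now exists p.
  - intros q Hq e' He'.
    pose (D := 2 * Cmod (A q) + 1 + e * (2 * Cmod q + 1)).
    pose proof (Cmod_ge_0 (A q)); pose proof (Cmod_ge_0 q).
    assert (HD : 0 < D) by (unfold D; nra).
    pose (w := Rmin 1 (e' / D)).
    assert (Hw : 0 < w) by (apply Rmin_glb_lt; [lra | now apply Rdiv_lt_0_compat]).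
    assert (Hw1 : w <= 1) by apply Rmin_l.
    assert (HwD : w * D <= e') by (apply Rle_div_r; [lra | apply Rmin_r]).
    assert (Hid : near0 (fun h => Cmod h < w)) by (exists w; auto).
    eapply near0_imp; [|exact (near0_and _ _ Hid (jet2_near A q w (HA q Hq) Hw))].
    cbv beta; intros h [H1 H2] _.
    pose proof (Cmod_minus_bound (A (q + h)%C) (A q)).
    pose proof (Cmod_triangle q h).
    pose proof (Cmod_ge_0 (A (q + h)%C)); pose proof (Cmod_ge_0 (q + h)).
    assert (I1 : Cmod (A (q + h)%C) ^ 2 < Cmod (A q) ^ 2 + w * (2 * Cmod (A q) + 1)) by nra.
    assert (I2 : Cmod (q + h) ^ 2 < Cmod q ^ 2 + w * (2 * Cmod q + 1)) by nra.
    apply (Rmult_lt_compat_l e) in I2; auto.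
    unfold D in HwD; nra.
  - assert (Hqb : bd q).
    { apply NNPP; intros Hn; apply (no_interior_max A q e He (HA q Hq)).
      eapply near0_imp; [|exact (Hint q Hq Hn)]; cbv beta; intros h Hh; exact (Hmax _ Hh). }
    specialize (Hmax p Hp); cbv beta in Hmax; specialize (Hbd q Hqb); specialize (HB q Hq).
    pose proof (Cmod_ge_0 (A q)); pose proof (Cmod_ge_0 q).
    assert (Cmod (A q) ^ 2 <= m ^ 2) by (apply pow_incr; lra).
    assert (Cmod q ^ 2 <= B ^ 2) by (apply pow_incr; lra).
    assert (e * Cmod q ^ 2 <= e * (B ^ 2 + 1)) by (apply Rmult_le_compat_l; lra).
    assert (e * (B ^ 2 + 1) = eps) by (unfold e; field; lra).
    pose proof (pow2_ge_0 (Cmod p)).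
    assert (0 <= e * Cmod p ^ 2) by (apply Rmult_le_pos; lra).
    lra. }
apply Rnot_lt_le; intros Hlt.
pose proof (Cmod_ge_0 (A p)).
specialize (key ((Cmod (A p) ^ 2 - m ^ 2) / 2) ltac:(nra)); nra.
Qed.

(** * The slit disc *)

Lemma exp_le_mono (x y : R) : x <= y -> exp x <= exp y.
Proof. intros [H | ->]; [now apply Rlt_le, exp_increasing | apply Rle_refl]. Qed.

Lemma exp_le_1 (x : R) : x <= 0 -> exp x <= 1.
Proof. rewrite <- exp_0; apply exp_le_mono. Qed.

(* The real part of this polynomial replaces the harmonic measure of the semicircle in the
   half disc [{|s| <= 1, Re s >= 0}]: it is at least 1 on the semicircle, nonnegative on
   the diameter, and its slope 1.41 at the origin is just below [sqrt 2], as is needed for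
   the constant 2 in front of [sqrt rho] in [slit_estimate].  The coefficients were found
   by linear programming. *)
Definition barrier (s : C) : C :=
  (RtoC (141/100) * s - RtoC (11/10) * s ^ 3 - RtoC (1/2) * s ^ 5
   + RtoC (11/10) * s ^ 4 + RtoC (1/10) * s ^ 6)%C.

Lemma barrier_re (x y : R) : fst (barrier (x, y)) =
  141/100 * x - 11/10 * (x^3 - 3*x*y^2) - 1/2 * (x^5 - 10*x^3*y^2 + 5*x*y^4)
  + 11/10 * (x^4 - 6*x^2*y^2 + y^4) + 1/10 * (x^6 - 15*x^4*y^2 + 15*x^2*y^4 - y^6).
Proof.
unfold barrier, Cminus, Cplus, Copp; simpl; field.
Qed.

Lemma barrier_circle (x y : R) : 0 <= x -> x ^ 2 + y ^ 2 = 1 -> 1 <= fst (barrier (x, y)).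
Proof.
intros Hx H; rewrite barrier_re.
assert (Hx1 : x <= 1) by nra.
replace (y ^ 6) with (y ^ 2 * y ^ 2 * y ^ 2) by ring.
replace (y ^ 4) with (y ^ 2 * y ^ 2) by ring.
replace (y ^ 2) with (1 - x ^ 2) by lra.
(* On the circle the barrier is a polynomial in [x] alone, equal to 1 at the corner [x = 0]; so [x]
   factors out and a quintic must be nonnegative on [[0, 1]]. At [x = 1] it is only 1/100, hence the
   subdivision. *)
match goal with |- 1 <= ?p =>
  replace p with (1 + x * (221/100 - 7*x + 28/5*x^2 + 4*x^3 - 8*x^4 + 16/5*x^5)) by field end.
assert (0 <= 221/100 - 7*x + 28/5*x^2 + 4*x^3 - 8*x^4 + 16/5*x^5); [|nra].
(* Bernstein form on [l, u]; the coefficients are nonnegative on the three pieces below. *)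
assert (Hbern : forall l u b0 b1 b2 b3 b4 b5,
  l <= x <= u /\ 0 <= b0 /\ 0 <= b1 /\ 0 <= b2 /\ 0 <= b3 /\ 0 <= b4 /\ 0 <= b5 ->
  0 <= b0*(u-x)^5 + b1*(u-x)^4*(x-l) + b2*(u-x)^3*(x-l)^2
       + b3*(u-x)^2*(x-l)^3 + b4*(u-x)*(x-l)^4 + b5*(x-l)^5).
{ intros; repeat first
    [lra | apply pow_le; lra | apply Rplus_le_le_0_compat | apply Rmult_le_pos]. }
destruct (Rle_dec x (1/2)) as [H0 | H0].
{ pose proof (Hbern (0) (1/2) (1768/25) (1208/5) (304) (928/5) (56) (168/25) ltac:(lra));
  lra. }
destruct (Rle_dec x (3/4)) as [H1 | H1].
{ pose proof (Hbern (1/2) (3/4) (5376/25) (3584/5) (4736/5) (3136/5) (1024/5) (656/25) ltac:(lra));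
  lra. }
pose proof (Hbern (3/4) (1) (656/25) (288/5) (192/5) (0) (0) (256/25) ltac:(lra));
  lra.
Qed.

Lemma barrier_axis (y : R) : -1 <= y <= 1 -> 0 <= fst (barrier (0, y)).
Proof.
intros Hy; rewrite barrier_re.
match goal with |- 0 <= ?p => replace p with (y ^ 4 * (11/10 - 1/10 * y ^ 2)) by field end.
apply Rmult_le_pos; [|nra].
replace (y ^ 4) with ((y ^ 2) ^ 2) by ring; apply pow2_ge_0.
Qed.

Lemma barrier_real (x : R) : 0 <= x <= 1 -> fst (barrier (x, 0)) <= 141/100 * x.
Proof.
intros Hx; rewrite barrier_re.
match goal with |- ?p <= _ =>
  replace p with (141/100 * x - x ^ 3 * (1 - x) * (11/10 + 1/10 * x * x) - 4/10 * x ^ 5) by field end.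
assert (0 <= x ^ 3) by (apply pow_le; lra).
assert (0 <= x ^ 5) by (apply pow_le; lra).
assert (0 <= x ^ 3 * (1 - x) * (11/10 + 1/10 * x * x)); [|lra].
repeat apply Rmult_le_pos; nra.
Qed.

Lemma jet2_opp (A : C -> C) (s : C) : jet2 A s -> jet2 (fun z => (- A z)%C) s.
Proof.
intros (c1 & c2 & r & Hr & H); exists (- c1)%C, (- c2)%C, (fun h => RtoC (-1) * r h)%C; split.
- apply bdd_mult; [apply bdd_const | exact Hr].
- eapply near0_imp; [|exact H]; cbv beta; intros h ->.
  replace (RtoC (-1)) with (- RtoC 1)%C by (unfold RtoC, Copp; simpl; f_equal; ring); ring.
Qed.

Lemma jet2_minus (A B : C -> C) (s : C) :
  jet2 A s -> jet2 B s -> jet2 (fun z => (A z - B z)%C) s.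
Proof.
intros HA HB; unfold Cminus; apply jet2_plus; [exact HA | now apply jet2_opp].
Qed.

Lemma jet2_barrier (s : C) : jet2 barrier s.
Proof.
unfold barrier.
repeat first [apply jet2_minus | apply jet2_plus | apply jet2_mult
             | apply jet2_const | apply jet2_pow | apply jet2_id].
Qed.

Lemma mobius_norm (rho : R) (w : C) : 0 <= rho < 1 -> Cmod w <= 1 ->
  (1 - rho * w)%C <> 0%C /\ Cmod ((rho - w) / (1 - rho * w))%C <= 1.
Proof.
intros Hr Hw.
assert (Hn : 0 < Cmod (1 - rho * w)%C).
{ pose proof (Cmod_minus_bound 1 (rho * w)%C) as H.
  rewrite Cmod_1, Cmod_mult, Cmod_R, Rabs_pos_eq in H by lra.
  pose proof (Cmod_ge_0 w); nra. }
assert (Hnz : (1 - rho * w)%C <> 0%C) by now apply Cmod_gt_0.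
split; [exact Hnz|].
rewrite Cmod_div by exact Hnz.
apply Rle_div_l; [exact Hn|]; rewrite Rmult_1_l.
apply Rsqr_incr_0; [|apply Cmod_ge_0 | lra]; rewrite !Rsqr_pow2.
assert (Hw2 : Cmod w ^ 2 <= 1).
{ replace 1 with (1 ^ 2) by ring; apply pow_incr; split; [apply Cmod_ge_0 | exact Hw]. }
rewrite !Cmod2_alt in *; destruct w as [x y].
unfold Re, Im, Cminus, Cplus, Copp, Cmult, RtoC in *; simpl fst in *; simpl snd in *.
(* This product is exactly [|1 - rho w|^2 - |rho - w|^2]. *)
assert (0 <= (1 - rho ^ 2) * (1 - (x ^ 2 + y ^ 2))) by (apply Rmult_le_pos; nra).
nra.
Qed.

(* [s |-> (rho - s^2) / (1 - rho s^2)] maps the half disc onto the disc slit along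
   [[rho, 1]], the diameter going to the slit. *)
Theorem slit_estimate (G : C -> C) (rho L : R) :
  0 < rho < 1 -> 0 <= L ->
  (forall z, Cmod z <= 1 -> jet2 G z) ->
  (forall z, Cmod z <= 1 -> Cmod (G z) <= 1) ->
  (forall t, rho <= t <= 1 -> Cmod (G (RtoC t)) <= exp (- L)) ->
  Cmod (G (RtoC (- rho))) <= exp (- (L * (1 - 2 * sqrt rho))).
Proof.
intros Hr HL HG HG1 Hslit.
pose (zm := fun s : C => ((rho - s * s) / (1 - rho * (s * s)))%C).
(* A two-constants argument in one function: the exponential has modulus [exp (L (1 - Re barrier))].
   It is at most 1 on the semicircle, where [|G| <= 1], and at most [exp L] on the diameter, where
   [|G| <= exp (- L)]; so [|A| <= 1] on the whole boundary. *)
pose (A := fun s : C => (G (zm s) * Cexp (L * (1 - barrier s)))%C).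
pose (S := fun s : C => Cmod s <= 1 /\ 0 <= fst s).
pose (bd := fun s : C => S s /\ (Cmod s = 1 \/ fst s = 0)).
assert (Hss : forall s : C, Cmod s <= 1 -> Cmod (s * s)%C <= 1).
{ intros s Hs; rewrite Cmod_mult; pose proof (Cmod_ge_0 s); nra. }
assert (Hfst : forall p h : C, Rabs (fst (p + h)%C - fst p) <= Cmod h).
{ intros p h; eapply Rle_trans; [|apply (re_le_Cmod h)].
  right; f_equal; unfold Re, Cplus; simpl; ring. }
assert (Hmod : forall p h : C, Rabs (Cmod (p + h)%C - Cmod p) <= Cmod h).
{ intros p h; pose proof (Cmod_triangle p h).
  pose proof (Cmod_minus_bound p (p + h)%C) as H1.
  replace (p - (p + h))%C with (- h)%C in H1 by ring; rewrite Cmod_opp in H1.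
  apply Rabs_le; lra. }
assert (HA : forall s, S s -> Cmod (A s) <= 1).
{ apply (maximum_principle S bd A 1 1).
  - intros p [H _]; exact H.
  - intros p Hp; apply not_and_or in Hp; destruct Hp as [Hp | Hp].
    + exists (Cmod p - 1); split; [lra|]; intros h Hh [H1 _].
      pose proof (Hmod p h) as H2; apply Rabs_le_between in H2; lra.
    + exists (- fst p); split; [lra|]; intros h Hh [_ H1].
      pose proof (Hfst p h) as H2; apply Rabs_le_between in H2; lra.
  - intros p [H1 H2] Hb.
    assert (H1' : Cmod p < 1).
    { destruct H1 as [H1 | H1]; [exact H1|]; exfalso; apply Hb; split; [split; lra | now left]. }
    assert (H2' : 0 < fst p).
    { destruct H2 as [H2 | H2]; [exact H2|]; exfalso; apply Hb; split; [split; lra | now right]. }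
    exists (Rmin (1 - Cmod p) (fst p)); split; [apply Rmin_glb_lt; lra|]; intros h Hh.
    pose proof (Rmin_l (1 - Cmod p) (fst p)); pose proof (Rmin_r (1 - Cmod p) (fst p)).
    pose proof (Hfst p h) as H3; apply Rabs_le_between in H3.
    pose proof (Hmod p h) as H4; apply Rabs_le_between in H4; split; lra.
  - intros p [Hp _]; unfold A.
    destruct (mobius_norm rho (p * p)%C ltac:(lra) (Hss p Hp)) as [Hnz Hz].
    apply jet2_mult.
    + apply (jet2_comp G zm); [now apply HG|]; unfold zm, Cdiv.
      apply jet2_mult.
      * repeat first [apply jet2_minus | apply jet2_mult | apply jet2_const | apply jet2_id].
      * apply (jet2_comp Cinv (fun s => (1 - rho * (s * s))%C)); [now apply jet2_inv|].
        repeat first [apply jet2_minus | apply jet2_mult | apply jet2_const | apply jet2_id].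
    + apply (jet2_comp Cexp (fun s => (L * (1 - barrier s))%C)); [apply jet2_Cexp|].
      apply jet2_mult; [apply jet2_const | apply jet2_minus; [apply jet2_const | apply jet2_barrier]].
  - lra.
  - intros [x y] [[Hs Hx] Hb]; unfold A; rewrite Cmod_mult, Cmod_Cexp; cbn [fst snd] in *.
    destruct (mobius_norm rho ((x, y) * (x, y))%C ltac:(lra) (Hss _ Hs)) as [Hnz Hz].
    replace (fst (L * (1 - barrier (x, y)))%C) with (L * (1 - fst (barrier (x, y)))) by
      (unfold Cmult, Cminus, Cplus, Copp, RtoC; simpl fst; simpl snd; ring).
    assert (Hexp0 : 0 < exp (L * (1 - fst (barrier (x, y))))) by apply exp_pos.
    destruct Hb as [Hb | Hb].
    + assert (Hxy : x ^ 2 + y ^ 2 = 1).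
      { pose proof (Cmod2_alt (x, y)) as E; rewrite Hb in E; unfold Re, Im in E; simpl in *; lra. }
      pose proof (barrier_circle x y Hx Hxy) as H1.
      assert (exp (L * (1 - fst (barrier (x, y)))) <= 1).
      { apply exp_le_1; nra. }
      apply Rle_trans with (1 * 1); [|lra].
      apply Rmult_le_compat; [apply Cmod_ge_0 | lra | now apply HG1 | assumption].
    + subst x.
      pose proof (Rmax_Cmod (0, y)) as Hm; cbn [fst snd] in Hm.
      pose proof (Rmax_r (Rabs 0) (Rabs y)).
      assert (Hy : Rabs y <= 1) by lra; apply Rabs_le_between in Hy.
      pose proof (barrier_axis y Hy) as H1.
      assert (Hden : 0 < 1 + rho * y ^ 2) by nra.
      replace (zm (0, y)) with (RtoC ((rho + y ^ 2) / (1 + rho * y ^ 2))).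
      2:{ unfold zm; rewrite RtoC_div by lra; f_equal; [|f_equal];
          unfold RtoC, Cminus, Cplus, Copp, Cmult; simpl; f_equal; ring. }
      assert (H2 : Cmod (G (RtoC ((rho + y ^ 2) / (1 + rho * y ^ 2)))) <= exp (- L)).
      { assert (0 <= y ^ 2 <= 1) by nra.
        apply Hslit; split; [apply Rle_div_r | apply Rle_div_l]; try lra.
        - assert (rho * (rho * y ^ 2) <= 1 * y ^ 2); [|lra].
          rewrite <- Rmult_assoc; apply Rmult_le_compat_r; nra.
        - assert (0 <= (1 - rho) * (1 - y ^ 2)) by (apply Rmult_le_pos; lra); lra. }
      apply Rle_trans with (exp (- L) * exp (L * (1 - fst (barrier (0, y))))).
      * now apply Rmult_le_compat_r; [lra|].
      * rewrite <- exp_plus; apply exp_le_1; nra. }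
(* Solution of [(rho - w) / (1 - rho w) = - rho]: the point [sqrt w] of the half disc is sent to
   [- rho]. *)
pose (w := 2 * rho / (1 + rho ^ 2)).
assert (Hden : 0 < 1 + rho ^ 2) by nra.
assert (Hw : 0 <= w <= 1).
{ unfold w; split; [apply Rle_div_r | apply Rle_div_l]; nra. }
assert (Hw2 : w <= 2 * rho) by (unfold w; apply Rle_div_l; nra).
pose (s0 := sqrt w).
assert (Hs0 : 0 <= s0 <= 1).
{ unfold s0; split; [apply sqrt_pos|]; rewrite <- sqrt_1; apply sqrt_le_1; lra. }
assert (Hs0w : s0 * s0 = w) by (apply sqrt_sqrt; lra).
assert (HS : S (RtoC s0)).
{ split; [rewrite Cmod_R, Rabs_pos_eq; lra | simpl; lra]. }
specialize (HA _ HS); unfold A in HA; rewrite Cmod_mult, Cmod_Cexp in HA.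
assert (Hz : zm (RtoC s0) = RtoC (- rho)).
{ unfold zm; rewrite <- RtoC_mult, Hs0w, <- RtoC_mult, <- !RtoC_minus.
  rewrite <- RtoC_div; [f_equal; unfold w; field; split; nra|].
  unfold w; intros E; apply (Rmult_eq_compat_r (1 + rho ^ 2)) in E.
  field_simplify in E; nra. }
rewrite Hz in HA.
replace (fst (L * (1 - barrier s0))%C) with (L * (1 - fst (barrier s0))) in HA by
  (unfold Cmult, Cminus, Cplus, Copp, RtoC; simpl fst; simpl snd; ring).
(* Here [s0^2 <= 2 rho], and [1.41^2 * 2 = 3.9762 < 4]. *)
assert (Hb : fst (barrier s0) <= 2 * sqrt rho).
{ apply Rle_trans with (141/100 * s0); [now apply barrier_real|].
  pose proof (sqrt_pos rho); pose proof (sqrt_sqrt rho ltac:(lra)).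
  apply Rnot_lt_le; intros Hlt; nra. }
apply Rmult_le_reg_r with (exp (L * (1 - fst (barrier s0)))); [apply exp_pos|].
apply Rle_trans with (1 := HA); rewrite <- exp_plus, <- exp_0 at 1; apply exp_le_mono; nra.
Qed.

(** * Complex polynomials and their factorization *)

Fixpoint cpoly (c : nat -> C) (n : nat) (z : C) : C :=
  match n with
  | O => c O
  | S k => (cpoly c k z + c (S k) * z ^ S k)%C
  end.

Definition lprod (f : C -> C) (l : list C) : C := fold_right (fun a x => (f a * x)%C) (RtoC 1) l.

Module FundamentalTheoremOfAlgebra.
Import all_boot all_algebra complex Rstruct.
Import GRing.Theory.

(** A transport of complex numbers to [R[i]], where algebraic closedness is available; sums,
    products and opposites agree by computation. *)
Definition toc (z : C) : R[i] := Complex z.1 z.2.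
Definition ofc (z : R[i]) : C := (complex.Re z, complex.Im z).

Lemma ofcK (z : R[i]) : toc (ofc z) = z. Proof. by case: z. Qed.
Lemma toc_inj : injective toc. Proof. by move=> [x y] [x' y'] [-> ->]. Qed.

Lemma tocD (z w : C) : toc (Cplus z w) = (toc z + toc w)%R.
Proof. by []. Qed.

Lemma tocM (z w : C) : toc (Cmult z w) = (toc z * toc w)%R.
Proof. by []. Qed.

Lemma tocN (z : C) : toc (Copp z) = (- toc z)%R. Proof. by []. Qed.

Lemma tocX (z : C) (n : nat) : toc (Cpow z n) = (toc z ^+ n)%R.
Proof. by elim: n => [|n IH]; rewrite ?expr0 //= tocM IH exprS. Qed.

Lemma toc_poly (c : nat -> C) (n : nat) (z : C) :
  toc (cpoly c n z) = (\sum_(i < n.+1) toc (c i) * toc z ^+ i)%R.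
Proof.
elim: n => [|n IH]; first by rewrite big_ord_recl big_ord0 addr0 expr0 mulr1.
by rewrite big_ord_recr /= -IH tocD tocM -tocX.
Qed.

Lemma toc_lprod (z : C) (r : seq R[i]) :
  toc (lprod (fun a => Cminus z a) (List.map ofc r)) = (\prod_(a <- r) (toc z - a))%R.
Proof.
elim: r => [|a r IH]; first by rewrite big_nil.
by rewrite big_cons -IH /= tocM /Cminus tocD tocN ofcK.
Qed.

Lemma monic_factor (c : nat -> C) (n N : nat) : (n < N)%N ->
  exists l : list C, length l = N /\
    forall z : C, Cplus (Cpow z N) (cpoly c n z) = lprod (fun a => Cminus z a) l.
Proof.
move=> ltnN.
pose q : {poly R[i]} := (\poly_(i < n.+1) toc (c i))%R.
pose p : {poly R[i]} := ('X^N + q)%R.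
have szq : (size q < size ('X^N : {poly R[i]})%R)%N.
  by rewrite size_polyXn ltnS (leq_trans (size_poly _ _)).
have szp : size p = N.+1 by rewrite /p size_polyDl // size_polyXn.
have lcp : lead_coef p = 1%R by rewrite /p lead_coefDl // lead_coefXn.
have [r Dp] := closed_field_poly_normal p.
rewrite lcp scale1r in Dp.
exists (List.map ofc r); split.
  have := szp; rewrite Dp size_prod_XsubC => -[<-].
  by rewrite List.length_map; elim: r {Dp} => //= a r ->.
move=> z; apply: toc_inj; rewrite toc_lprod tocD tocX toc_poly.
transitivity (p.[toc z])%R.
  by rewrite /p hornerD hornerXn horner_poly.
rewrite Dp horner_prod; apply: eq_bigr => a _; by rewrite hornerXsubC.
Qed.
End FundamentalTheoremOfAlgebra.

Lemma monic_factor (c : nat -> C) (n N : nat) : (n < N)%nat ->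
  exists l : list C, length l = N /\
    forall z : C, (z ^ N + cpoly c n z = lprod (fun a => z - a) l)%C.
Proof.
intros H; apply FundamentalTheoremOfAlgebra.monic_factor.
now apply (ssrbool.introT ssrnat.ltP).
Qed.

(** * Finite Blaschke products with projected zeros *)

Lemma lprod_mult (f g : C -> C) (l : list C) :
  lprod (fun a => (f a * g a)%C) l = (lprod f l * lprod g l)%C.
Proof. induction l as [|a l IH]; simpl; [ring | rewrite IH; ring]. Qed.

Lemma lprod_Cmod_le (f g : C -> C) (l : list C) :
  (forall a, In a l -> Cmod (f a) <= Cmod (g a)) -> Cmod (lprod f l) <= Cmod (lprod g l).
Proof.
induction l as [|a l IH]; intros H; simpl in *; [lra|].
rewrite !Cmod_mult; apply Rmult_le_compat; auto using Cmod_ge_0.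
Qed.

Lemma lprod_zero (f : C -> C) (a : C) (l : list C) : In a l -> f a = 0%C -> lprod f l = 0%C.
Proof.
intros Ha H; induction l as [|b l IH]; simpl in *; [easy|].
destruct Ha as [-> | Ha]; [rewrite H | rewrite (IH Ha)]; ring.
Qed.

Lemma jet2_lprod (f : C -> C -> C) (l : list C) (s : C) :
  (forall a, In a l -> jet2 (f a) s) -> jet2 (fun z => lprod (fun a => f a z) l) s.
Proof.
induction l as [|a l IH]; intros H; simpl in *; [apply jet2_const|].
apply jet2_mult; auto.
Qed.

Lemma jet2_cpoly (c : nat -> C) (n : nat) (s : C) : jet2 (cpoly c n) s.
Proof.
induction n as [|n IH]; simpl; [apply jet2_const|].
apply (jet2_plus (cpoly c n) (fun z => (c (S n) * z ^ S n)%C)); [exact IH|].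
apply jet2_mult; [apply jet2_const | apply (jet2_pow (fun z => z)), jet2_id].
Qed.

(** With the moduli fixed, both factors depend on the angle only through [x], the real part of
    [z * Cconj a]. The comparisons below become inequalities in this one real variable. *)
Lemma Cmod_sub_factors (z a : C) :
  let x := fst z * fst a + snd z * snd a in
  Rabs x <= Cmod z * Cmod a /\
  Cmod (z - a)%C ^ 2 = Cmod z ^ 2 + Cmod a ^ 2 - 2 * x /\
  Cmod (1 - Cconj a * z)%C ^ 2 = 1 + (Cmod z * Cmod a) ^ 2 - 2 * x.
Proof.
intros x; rewrite Rpow_mult_distr, !Cmod2_alt; destruct z as [u v], a as [b d].
unfold x, Re, Im, Cconj, Cminus, Cplus, Copp, Cmult, RtoC; simpl fst; simpl snd.
split; [|split; ring].
pose proof (re_le_Cmod ((u, v) * Cconj (b, d))%C) as H.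
rewrite Cmod_mult, Cmod_conj in H; unfold Re, Cconj, Cmult in H; simpl in H.
replace (u * b + v * d) with (u * b - v * - d) by ring; exact H.
Qed.

(* The pseudohyperbolic distance |z - a| / |1 - conj a z| lies between its values
   at collinear points of the same moduli, on the same side and on opposite sides of 0. *)
Lemma pseudohyperbolic_lower (z a : C) : Cmod z < 1 -> Cmod a < 1 ->
  Rabs (Cmod z - Cmod a) * Cmod (1 - Cconj a * z)%C
  <= (1 - Cmod z * Cmod a) * Cmod (z - a)%C.
Proof.
intros Hz Ha; destruct (Cmod_sub_factors z a) as (Hx & E1 & E2).
set (x := fst z * fst a + snd z * snd a) in *; clearbody x.
pose proof (Cmod_ge_0 z); pose proof (Cmod_ge_0 a).
set (t := Cmod z) in *; set (s := Cmod a) in *.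
assert (t * s < 1) by nra.
apply Rsqr_incr_0;
  [|apply Rmult_le_pos; [apply Rabs_pos | apply Cmod_ge_0]
   |apply Rmult_le_pos; [lra | apply Cmod_ge_0]].
rewrite !Rsqr_mult, !Rsqr_pow2, <- Rsqr_pow2 with (x := Rabs _), <- Rsqr_abs, Rsqr_pow2, E1, E2.
apply Rabs_le_between in Hx.
(* Twice this product is the difference of the two squared sides; for the upper bound the last
   factor becomes [t * s + x]. *)
assert (0 <= (1 - t ^ 2) * (1 - s ^ 2) * (t * s - x)); [|nra].
apply Rmult_le_pos; [apply Rmult_le_pos; nra | lra].
Qed.

Lemma pseudohyperbolic_upper (z a : C) : Cmod z < 1 -> Cmod a < 1 ->
  Cmod (z - a)%C * (1 + Cmod z * Cmod a)
  <= (Cmod z + Cmod a) * Cmod (1 - Cconj a * z)%C.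
Proof.
intros Hz Ha; destruct (Cmod_sub_factors z a) as (Hx & E1 & E2).
set (x := fst z * fst a + snd z * snd a) in *; clearbody x.
pose proof (Cmod_ge_0 z); pose proof (Cmod_ge_0 a).
set (t := Cmod z) in *; set (s := Cmod a) in *.
assert (0 <= t * s) by nra.
apply Rsqr_incr_0;
  [|apply Rmult_le_pos; [apply Cmod_ge_0 | lra]
   |apply Rmult_le_pos; [lra | apply Cmod_ge_0]].
rewrite !Rsqr_mult, !Rsqr_pow2, E1, E2.
apply Rabs_le_between in Hx.
assert (0 <= (1 - t ^ 2) * (1 - s ^ 2) * (t * s + x)); [|nra].
apply Rmult_le_pos; [apply Rmult_le_pos; nra | lra].
Qed.

(** Each factor is [(z - |a|) / (1 - |a| z)], written as the opposite of the quotient in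
    [mobius_norm] so that its bound applies directly. *)
Definition projected_blaschke (l : list C) (z : C) : C :=
  lprod (fun a => (- ((Cmod a - z) / (1 - Cmod a * z)))%C) l.

(** Numerator and denominator of the original product stay apart, because they are later
    approximated separately, by [g] and by 1. *)
Lemma projected_blaschke_lower (l : list C) (z : C) :
  (forall a, In a l -> Cmod a < 1) -> Cmod z < 1 ->
  Cmod (projected_blaschke l (Cmod z)) * Cmod (lprod (fun a => (1 - Cconj a * z)%C) l)
  <= Cmod (lprod (fun a => (z - a)%C) l).
Proof.
intros Hl Hz; unfold projected_blaschke; rewrite <- Cmod_mult, <- lprod_mult.
apply lprod_Cmod_le; intros a Ha; specialize (Hl a Ha).
pose proof (Cmod_ge_0 z); pose proof (Cmod_ge_0 a).
assert (0 < 1 - Cmod a * Cmod z) by nra.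
rewrite Cmod_mult, Cmod_opp, <- RtoC_mult, <- !RtoC_minus, <- RtoC_div by lra.
rewrite Cmod_R, Rabs_div, (Rabs_pos_eq (1 - _)) by lra.
pose proof (pseudohyperbolic_lower z a Hz Hl) as HP.
rewrite Rabs_minus_sym in HP.
unfold Rdiv; rewrite Rmult_assoc, (Rmult_comm (/ _)), <- Rmult_assoc.
apply Rle_div_l; [lra|]; lra.
Qed.

Lemma projected_blaschke_upper (l : list C) (z : C) (t : R) :
  (forall a, In a l -> Cmod a < 1) -> Cmod z <= t < 1 ->
  Cmod (lprod (fun a => (z - a)%C) l)
  <= Cmod (projected_blaschke l (RtoC (- t))) * Cmod (lprod (fun a => (1 - Cconj a * z)%C) l).
Proof.
intros Hl Hz; unfold projected_blaschke; rewrite <- Cmod_mult, <- lprod_mult.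
apply lprod_Cmod_le; intros a Ha; specialize (Hl a Ha).
pose proof (Cmod_ge_0 z); pose proof (Cmod_ge_0 a).
assert (0 <= Cmod a * Cmod z) by nra.
assert (0 <= Cmod a * t) by nra.
rewrite Cmod_mult, Cmod_opp, <- RtoC_mult, <- !RtoC_minus, <- RtoC_div by lra.
rewrite Cmod_R, Rabs_div, !Rabs_pos_eq by lra.
pose proof (pseudohyperbolic_upper z a ltac:(lra) Hl) as HP.
set (X := Cmod (1 - Cconj a * z)%C) in *.
assert (HX : 0 <= X) by apply Cmod_ge_0.
unfold Rdiv; rewrite Rmult_assoc, (Rmult_comm (/ _)), <- Rmult_assoc.
apply Rle_div_r; [lra|].
(* The quotient [(t + |a|) / (1 + t |a|)] increases with [t]; this is what allows [|z| <= t] instead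
   of equality. *)
assert (HQ : (Cmod z + Cmod a) * (1 + t * Cmod a) <= (t + Cmod a) * (1 + Cmod z * Cmod a)).
{ assert (0 <= (t - Cmod z) * (1 - Cmod a ^ 2)) by (apply Rmult_le_pos; nra). nra. }
apply Rmult_le_reg_r with (1 + Cmod z * Cmod a); [lra|].
apply Rle_trans with ((Cmod z + Cmod a) * X * (1 + t * Cmod a)).
- replace (Cmod (z - a) * (1 - Cmod a * - t) * (1 + Cmod z * Cmod a))
    with (Cmod (z - a) * (1 + Cmod z * Cmod a) * (1 + t * Cmod a)) by ring.
  apply Rmult_le_compat_r; lra.
- replace ((Cmod z + Cmod a) * X * (1 + t * Cmod a))
    with ((Cmod z + Cmod a) * (1 + t * Cmod a) * X) by ring.
  replace ((Cmod a - - t) * X * (1 + Cmod z * Cmod a))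
    with ((t + Cmod a) * (1 + Cmod z * Cmod a) * X) by ring.
  now apply Rmult_le_compat_r.
Qed.

Lemma projected_blaschke_disc (l : list C) (z : C) :
  (forall a, In a l -> Cmod a < 1) -> Cmod z <= 1 ->
  jet2 (projected_blaschke l) z /\ Cmod (projected_blaschke l z) <= 1.
Proof.
intros Hl Hz; unfold projected_blaschke; split.
- apply (jet2_lprod (fun a z => (- ((Cmod a - z) / (1 - Cmod a * z)))%C)).
  intros a Ha; specialize (Hl a Ha).
  destruct (mobius_norm (Cmod a) z (conj (Cmod_ge_0 a) Hl) Hz) as [Hnz _].
  apply jet2_opp; unfold Cdiv; apply jet2_mult.
  + apply jet2_minus; [apply jet2_const | apply jet2_id].
  + apply (jet2_comp Cinv (fun z => (1 - Cmod a * z)%C)); [now apply jet2_inv|].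
    repeat first [apply jet2_minus | apply jet2_mult | apply jet2_const | apply jet2_id].
- apply Rle_trans with (Cmod (lprod (fun _ => RtoC 1) l)).
  + apply lprod_Cmod_le; intros a Ha; specialize (Hl a Ha).
    destruct (mobius_norm (Cmod a) z (conj (Cmod_ge_0 a) Hl) Hz) as [_ H].
    now rewrite Cmod_1, Cmod_opp.
  + clear; induction l; simpl; [rewrite Cmod_1; lra | rewrite Cmod_mult, Cmod_1; lra].
Qed.

Lemma disc_maximum (A : C -> C) (r m : R) : (forall z, Cmod z <= r -> jet2 A z) -> 0 <= m ->
  (forall z, Cmod z = r -> Cmod (A z) <= m) -> forall z, Cmod z <= r -> Cmod (A z) <= m.
Proof.
intros HA Hm Hb.
apply (maximum_principle (fun z => Cmod z <= r) (fun z => Cmod z = r) A r m); auto.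
- intros p Hp; exists (Cmod p - r); split; [lra|]; intros h Hh H1.
  pose proof (Cmod_minus_bound p (p + h)%C) as H2.
  replace (p - (p + h))%C with (- h)%C in H2 by ring; rewrite Cmod_opp in H2; lra.
- intros p Hp Hn; exists (r - Cmod p); split; [lra|]; intros h Hh.
  pose proof (Cmod_triangle p h); lra.
Qed.

(** * Reversed polynomials *)

Lemma cpoly_shift (c : nat -> C) (n : nat) (z : C) :
  cpoly c (S n) z = (c O + z * cpoly (fun i => c (S i)) n z)%C.
Proof.
induction n as [|n IH]; [simpl; ring|].
change (cpoly c (S (S n)) z) with (cpoly c (S n) z + c (S (S n)) * z ^ S (S n))%C.
rewrite IH; simpl; ring.
Qed.

(** The point [w] is the reflection [1 / conj z] of [z] in the unit circle. On the circle [w = z],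
    so a polynomial and its reversal have equal modulus there. *)
Lemma cpoly_reverse (c : nat -> C) (n : nat) (z w : C) : (z * Cconj w = 1)%C ->
  cpoly (fun i => Cconj (c (n - i)%nat)) n z = (z ^ n * Cconj (cpoly c n w))%C.
Proof.
intros Hzw; induction n as [|n IH]; [simpl; ring|].
rewrite cpoly_shift.
change (fun i => Cconj (c (S n - S i)%nat)) with (fun i => Cconj (c (n - i)%nat)).
change (cpoly c (S n) w) with (cpoly c n w + c (S n) * w ^ S n)%C.
rewrite IH, Nat.sub_0_r.
rewrite Cplus_conj, Cmult_conj, Cpow_conj.
replace (z ^ S n * (Cconj (cpoly c n w) + Cconj (c (S n)) * Cconj w ^ S n))%C
  with (z * z ^ n * Cconj (cpoly c n w) + Cconj (c (S n)) * (z * Cconj w) ^ S n)%C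
  by (rewrite Cpow_mult_l; simpl; ring).
rewrite Hzw, Cpow_1_l; ring.
Qed.

Lemma lprod_reverse (l : list C) (z w : C) : (z * Cconj w = 1)%C ->
  lprod (fun a => (1 - Cconj a * z)%C) l
  = (z ^ length l * Cconj (lprod (fun a => (w - a)%C) l))%C.
Proof.
intros Hzw; induction l as [|a l IH]; simpl.
- unfold Cconj, RtoC, Cmult; simpl; f_equal; ring.
- rewrite Cmult_conj, Cminus_conj, IH.
  replace (z * z ^ length l * ((Cconj w - Cconj a) * Cconj (lprod (fun a => w - a) l)))%C
    with ((z * Cconj w - Cconj a * z) * (z ^ length l * Cconj (lprod (fun a => w - a) l)))%C by ring.
  now rewrite Hzw.
Qed.

(** * The estimate for polynomials *)

(* [z^N + g] over its reversal is a finite Blaschke product close to [g] on compact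
   subsets of the disc: this is how Blaschke products stand in for bounded functions. *)
Lemma blaschke_approximation (c : nat -> C) (n N : nat) : (n < N)%nat ->
  (forall z, Cmod z = 1 -> Cmod (cpoly c n z) < 1) ->
  exists l : list C, (forall a, In a l -> Cmod a < 1) /\
    forall z, 0 < Cmod z <= 1 ->
      Cmod (lprod (fun a => (z - a)%C) l - cpoly c n z)%C <= Cmod z ^ (N - n) /\
      Cmod (lprod (fun a => (1 - Cconj a * z)%C) l - 1)%C <= Cmod z ^ (N - n).
Proof.
intros HnN Hg.
destruct (monic_factor c n N HnN) as (l & Hlen & Hl).
pose (g' := cpoly (fun i => Cconj (c (n - i)%nat)) n).
assert (Hinv : forall z : C, z <> 0%C -> (z * Cconj (/ Cconj z) = 1)%C).
{ intros z Hz; assert (Cconj z <> 0%C).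
  { apply Cmod_gt_0; rewrite Cmod_conj; now apply Cmod_gt_0. }
  rewrite Cinv_conj, Cconj_conj by assumption; now field. }
(* On the circle [|g'| = |g|], and [g'] is again a polynomial, so the maximum principle applies. *)
assert (Hg' : forall z, Cmod z <= 1 -> Cmod (g' z) <= 1).
{ apply disc_maximum; [intros; apply jet2_cpoly | lra |]; intros z Hz.
  assert (Hz0 : z <> 0%C) by (apply Cmod_gt_0; lra).
  unfold g'; rewrite (cpoly_reverse c n z (/ Cconj z)) by auto.
  rewrite Cmod_mult, Cmod_pow, Hz, pow1, Cmod_conj, Rmult_1_l.
  apply Rlt_le, Hg. rewrite Cmod_inv, Cmod_conj, Hz by
    (apply Cmod_gt_0; rewrite Cmod_conj; lra). apply Rinv_1. }
exists l; split.
(* A direct substitute for Rouché. A zero satisfies [|a|^N = |g a|]; this contradicts [|g| < 1] if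
   [|a| = 1], and for [|a| > 1] reflection gives [|g a| <= |a|^n < |a|^N]. *)
- intros a Ha.
  assert (E : (a ^ N + cpoly c n a = 0)%C).
  { rewrite Hl; apply (lprod_zero _ a); [exact Ha | ring]. }
  assert (E' : Cmod a ^ N = Cmod (cpoly c n a)).
  { rewrite <- Cmod_pow, <- Cmod_opp; f_equal.
    transitivity (a ^ N + cpoly c n a - a ^ N)%C; [rewrite E; ring | ring]. }
  apply Rnot_le_lt; intros [H1 | H1].
  2:{ specialize (Hg a (eq_sym H1)); rewrite <- H1, pow1 in E'; lra. }
  assert (Ha0 : a <> 0%C) by (apply Cmod_gt_0; lra).
  assert (Hca : Cconj a <> 0%C) by (apply Cmod_gt_0; rewrite Cmod_conj; lra).
  pose (w := (/ Cconj a)%C).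
  assert (Hw : Cmod w <= 1).
  { unfold w; rewrite Cmod_inv, Cmod_conj by assumption.
    rewrite <- Rinv_1; apply Rinv_le_contravar; lra. }
  specialize (Hg' w Hw); unfold g' in Hg'.
  rewrite (cpoly_reverse c n w a) in Hg' by (unfold w; now field).
  rewrite Cmod_mult, Cmod_pow, Cmod_conj, <- E' in Hg'.
  assert (Hwa : Cmod w = / Cmod a) by (unfold w; now rewrite Cmod_inv, Cmod_conj).
  rewrite Hwa, pow_inv in Hg'.
  assert (Hp : Cmod a ^ n < Cmod a ^ N) by (now apply Rlt_pow).
  assert (Hp0 : 0 < Cmod a ^ n) by (apply pow_lt; lra).
  apply (Rmult_le_compat_l (Cmod a ^ n)) in Hg'; [|lra].
  rewrite <- Rmult_assoc, Rinv_r in Hg'; lra.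
- intros z Hz.
  assert (Hz0 : z <> 0%C) by (apply Cmod_gt_0; lra).
  assert (HN : N = (N - n + n)%nat) by lia.
  assert (Hp0 : 0 <= Cmod z ^ (N - n)) by (apply pow_le; lra).
  split.
  + rewrite <- Hl; replace (z ^ N + cpoly c n z - cpoly c n z)%C with (z ^ N)%C by ring.
    rewrite Cmod_pow; rewrite HN at 1; rewrite pow_add.
    assert (Cmod z ^ n <= 1) by (rewrite <- (pow1 n); apply pow_incr; lra).
    nra.
  + rewrite (lprod_reverse l z (/ Cconj z)), <- Hl, Hlen by auto.
    rewrite Cplus_conj, Cpow_conj.
    (* The reversal of [z^N + g] is [1 + z^(N - n) g'], hence close to 1. *)
    replace (z ^ N * (Cconj (/ Cconj z) ^ N + Cconj (cpoly c n (/ Cconj z))) - 1)%C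
      with (z ^ (N - n) * g' z)%C.
    2:{ unfold g'; rewrite (cpoly_reverse c n z (/ Cconj z)) by auto.
        transitivity ((z * Cconj (/ Cconj z)) ^ N
          + z ^ N * Cconj (cpoly c n (/ Cconj z)) - 1)%C; [|rewrite Cpow_mult_l; ring].
        rewrite Hinv, Cpow_1_l by assumption.
        rewrite HN at 2; rewrite Cpow_add_r; ring. }
    rewrite Cmod_mult, Cmod_pow.
    specialize (Hg' z ltac:(lra)). pose proof (Cmod_ge_0 (g' z)). nra.
Qed.

(** The parameter [x] bounds every error at once: on [|z| <= 1 - x] the numerator is within [x] of
    [g] and the denominator within [x] of 1. This gives [(m + x) / (1 - x)] on the slit and the
    factor [1 + x] and summand [x] at [z0]. *)
Lemma polynomial_bound_step (c : nat -> C) (n : nat) (rho m x : R) (z0 : C) :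
  0 < m -> 0 < x < 1 -> (m + x) / (1 - x) <= 1 -> rho < (1 - x) ^ 2 ->
  (forall z, Cmod z = 1 -> Cmod (cpoly c n z) < 1) ->
  (forall t, rho < t < 1 -> exists z, Cmod z = t /\ Cmod (cpoly c n z) <= m) ->
  0 < Cmod z0 <= rho ->
  Cmod (cpoly c n z0) <=
    (1 + x) * exp (ln ((m + x) / (1 - x)) * (1 - 2 * (sqrt rho / (1 - x)))) + x.
Proof.
intros Hm Hx Hmx Hrx Hg Hmin Hz0.
pose (tau := 1 - x); assert (Htau : 0 < tau < 1) by (unfold tau; lra).
fold tau in Hmx, Hrx |- *.
destruct (pow_lt_1_zero tau ltac:(rewrite Rabs_pos_eq; lra) x ltac:(lra)) as [k Hk].
specialize (Hk k (le_n k)); rewrite Rabs_pos_eq in Hk by (apply pow_le; lra).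
(* With this degree the error is [|z|^(k + 1)], at most [tau^k < x] for [|z| <= tau]. *)
destruct (blaschke_approximation c n (S (n + k)) ltac:(lia) Hg) as (l & Hl & Happ).
assert (Hsmall : forall z, 0 < Cmod z <= tau ->
  Cmod (lprod (fun a => (z - a)%C) l - cpoly c n z)%C <= x /\
  Cmod (lprod (fun a => (1 - Cconj a * z)%C) l - 1)%C <= x).
{ intros z Hz.
  assert (Cmod z ^ (S (n + k) - n) <= x).
  { replace (S (n + k) - n)%nat with (S k) by lia; simpl.
    assert (Cmod z ^ k <= tau ^ k) by (apply pow_incr; lra).
    assert (0 <= Cmod z ^ k) by (apply pow_le; lra). nra. }
  destruct (Happ z ltac:(lra)); split; lra. }
pose (G := fun z : C => projected_blaschke l (tau * z)%C).
pose (L := - ln ((m + x) / tau)).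
assert (Hq0 : 0 < (m + x) / tau) by (apply Rdiv_lt_0_compat; lra).
assert (HL : 0 <= L).
{ unfold L; rewrite <- ln_1.
  destruct Hmx as [H | H]; [apply (ln_increasing _ _ Hq0) in H; rewrite ln_1 in *; lra |].
  rewrite H, ln_1; lra. }
assert (Hscale : forall z, Cmod z <= 1 -> Cmod (tau * z)%C <= 1).
{ intros z Hz; rewrite Cmod_mult, Cmod_R, Rabs_pos_eq by lra; pose proof (Cmod_ge_0 z); nra. }
(* After scaling by [tau], the slit starts at [rho / tau]. The second power of [tau] puts this
   strictly above [rho], as the open range of radii in [Hmin] demands, and keeps
   [|z0| <= rho / tau]. *)
assert (Hr0 : 0 < rho / tau ^ 2) by (apply Rdiv_lt_0_compat; nra).
assert (Hest : Cmod (G (RtoC (- (rho / tau ^ 2)))) <= exp (- (L * (1 - 2 * sqrt (rho / tau ^ 2))))).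
{ apply slit_estimate; [split; [exact Hr0 | apply Rlt_div_l; nra] | exact HL | | | ].
  - intros z Hz; unfold G.
    apply (jet2_comp (projected_blaschke l) (fun z => (tau * z)%C)).
    + now apply projected_blaschke_disc; auto.
    + apply jet2_mult; [apply jet2_const | apply jet2_id].
  - intros z Hz; now apply projected_blaschke_disc; auto.
  - intros t [Ht1 Ht2]; unfold G; rewrite <- RtoC_mult.
    assert (Ht3 : rho / tau <= tau * t).
    { apply Rle_trans with (tau * (rho / tau ^ 2)); [right; field; lra|].
      apply Rmult_le_compat_l; lra. }
    assert (Ht4 : rho < rho / tau) by (apply Rlt_div_r; nra).
    destruct (Hmin (tau * t)) as (z & Hz & Hgz); [split; nra|].
    destruct (Hsmall z) as [H1 H2]; [nra|].
    pose proof (projected_blaschke_lower l z Hl ltac:(nra)) as H3; rewrite Hz in H3.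
    pose proof (Cmod_minus_bound (lprod (fun a => (z - a)%C) l) (cpoly c n z)) as H4.
    pose proof (Cmod_minus_bound 1 (lprod (fun a => (1 - Cconj a * z)%C) l)) as H5.
    set (q := lprod (fun a => (1 - Cconj a * z)%C) l) in *.
    rewrite Cmod_1 in H5.
    replace (1 - q)%C with (- (q - 1))%C in H5 by ring; rewrite Cmod_opp in H5.
    unfold L; rewrite Ropp_involutive, exp_ln by exact Hq0.
    apply Rle_div_r; [lra|].
    pose proof (Cmod_ge_0 (projected_blaschke l (RtoC (tau * t)))).
    apply Rle_trans with (Cmod (projected_blaschke l (RtoC (tau * t))) * Cmod q); [|lra].
    apply Rmult_le_compat_l; [assumption | unfold tau; lra]. }
rewrite sqrt_div_alt, sqrt_pow2 in Hest by nra.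
unfold L in Hest.
replace (- (- ln ((m + x) / tau) * (1 - 2 * (sqrt rho / tau))))
  with (ln ((m + x) / tau) * (1 - 2 * (sqrt rho / tau))) in Hest by ring.
set (E := exp _) in *.
assert (HE : 0 < E) by apply exp_pos.
assert (Hrt : rho / tau < 1) by (apply Rlt_div_l; nra).
assert (Hrt' : rho < rho / tau) by (apply Rlt_div_r; nra).
assert (Hrt'' : rho <= tau) by nra.
pose proof (projected_blaschke_upper l z0 (rho / tau) Hl ltac:(lra)) as H6.
unfold G in Hest.
replace (tau * RtoC (- (rho / tau ^ 2)))%C with (RtoC (- (rho / tau))) in Hest
  by (rewrite <- RtoC_mult; f_equal; field; lra).
destruct (Hsmall z0) as [H1 H2]; [lra|].
pose proof (Cmod_minus_bound (cpoly c n z0) (lprod (fun a => (z0 - a)%C) l)) as H4.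
replace (cpoly c n z0 - lprod (fun a => z0 - a) l)%C
  with (- (lprod (fun a => z0 - a) l - cpoly c n z0))%C in H4 by ring.
rewrite Cmod_opp in H4.
pose proof (Cmod_minus_bound (lprod (fun a => (1 - Cconj a * z0)%C) l) 1) as H5.
rewrite Cmod_1 in H5.
pose proof (Cmod_ge_0 (lprod (fun a => (1 - Cconj a * z0)%C) l)).
assert (Cmod (projected_blaschke l (RtoC (- (rho / tau))))
  * Cmod (lprod (fun a => (1 - Cconj a * z0)%C) l) <= E * (1 + x)).
{ apply Rmult_le_compat; [apply Cmod_ge_0 | lra | exact Hest | lra]. }
lra.
Qed.

(** Continuity at 0 is obtained from differentiability, which [auto_derive] checks for the explicit
    error bounds. *)
Lemma le_limit_right (f : R -> R) (a d : R) : ex_derive f 0 -> 0 < d ->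
  (forall x, 0 < x < d -> a <= f x) -> a <= f 0.
Proof.
intros Hf Hd H; apply Rnot_lt_le; intros Hlt.
pose proof (ex_derive_continuous f 0 Hf) as Hc.
apply continuity_pt_filterlim in Hc.
destruct (Hc (a - f 0) ltac:(lra)) as (e & He & Hc').
pose (x := Rmin (d / 2) (e / 2)).
assert (Hx : 0 < x) by (apply Rmin_glb_lt; lra).
assert (x <= d / 2) by apply Rmin_l; assert (x <= e / 2) by apply Rmin_r.
specialize (H x ltac:(lra)).
specialize (Hc' x); simpl in Hc'; unfold Rdist in Hc'.
rewrite Rminus_0_r, Rabs_pos_eq in Hc' by lra.
specialize (Hc' ltac:(split; [split; [exact I | lra] | lra])).
apply Rabs_lt_between in Hc'; lra.
Qed.

Theorem polynomial_bound (c : nat -> C) (n : nat) (rho m : R) (z0 : C) :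
  0 < m < 1 -> 0 < rho < 1 ->
  (forall z, Cmod z = 1 -> Cmod (cpoly c n z) < 1) ->
  (forall t, rho < t < 1 -> exists z, Cmod z = t /\ Cmod (cpoly c n z) <= m) ->
  Cmod z0 = rho -> Cmod (cpoly c n z0) <= exp (ln m * (1 - 2 * sqrt rho)).
Proof.
intros Hm Hr Hg Hmin Hz0.
pose (f := fun x => (1 + x) * exp (ln ((m + x) / (1 - x)) * (1 - 2 * (sqrt rho / (1 - x)))) + x).
replace (exp (ln m * (1 - 2 * sqrt rho))) with (f 0).
2:{ unfold f; rewrite !Rplus_0_r, Rminus_0_r, !Rdiv_1_r, Rmult_1_l; reflexivity. }
(* The first bound gives [m + x <= 1 - x]; the second gives [rho < 1 - 2 x < (1 - x)^2]. *)
apply (le_limit_right f _ (Rmin ((1 - m) / 2) ((1 - rho) / 2))).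
- unfold f; auto_derive.
  rewrite !Rplus_0_r, Ropp_0, Rplus_0_r; repeat split; try lra.
- apply Rmin_glb_lt; lra.
- intros x Hx.
  pose proof (Rmin_l ((1 - m) / 2) ((1 - rho) / 2)).
  pose proof (Rmin_r ((1 - m) / 2) ((1 - rho) / 2)).
  apply polynomial_bound_step; auto; try lra.
  + apply Rle_div_l; lra.
  + nra.
Qed.

(** * Entire functions *)

Lemma psum_cpoly (a : nat -> C) (z : C) (n : nat) : psum a z n = cpoly a n z.
Proof.
induction n as [|n IH].
- change (a O * 1 = a O)%C; ring.
- change (psum a z n + a (S n) * z ^ S n = cpoly a n z + a (S n) * z ^ S n)%C.
  now rewrite IH.
Qed.

Lemma series_fun_lim (a : nat -> C) (z : C) : entire_series a ->
  forall eps, 0 < eps -> exists N, forall n, (N <= n)%nat ->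
    Cmod (cpoly a n z - series_fun a z)%C < eps.
Proof.
intros Ha eps He.
destruct (epsilon_spec (inhabits C0) _ (Ha z) eps He) as [N HN].
exists N; intros n Hn; rewrite <- psum_cpoly; exact (HN n Hn).
Qed.

(** Convergence at the single point [2 R] makes the terms there eventually at most 2, so on
    [|z| <= R] they decay like powers of 1/2. *)
Lemma series_fun_uniform_ge (a : nat -> C) (R eps : R) : entire_series a -> 0 < R -> 0 < eps ->
  exists n0, forall n z, (n0 <= n)%nat -> Cmod z <= R ->
    Cmod (series_fun a z - cpoly a n z)%C <= eps.
Proof.
intros Ha HR He.
destruct (series_fun_lim a (RtoC (2 * R)) Ha 1 Rlt_0_1) as [N HN].
assert (Hterm : forall n z, (N <= n)%nat -> Cmod z <= R ->
  Cmod (a (S n) * z ^ S n)%C <= (1 / 2) ^ n).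
{ intros n z Hn Hz.
  pose proof (HN n Hn) as H1; pose proof (HN (S n) (le_S _ _ Hn)) as H2.
  change (cpoly a (S n) (RtoC (2 * R)))
    with (cpoly a n (RtoC (2 * R)) + a (S n) * RtoC (2 * R) ^ S n)%C in H2.
  set (s := series_fun a (RtoC (2 * R))) in *.
  pose proof (Cmod_minus_bound (a (S n) * RtoC (2 * R) ^ S n)%C
    (cpoly a n (RtoC (2 * R)) + a (S n) * RtoC (2 * R) ^ S n - s)%C) as H3.
  replace (a (S n) * RtoC (2 * R) ^ S n
    - (cpoly a n (RtoC (2 * R)) + a (S n) * RtoC (2 * R) ^ S n - s))%C
    with (- (cpoly a n (RtoC (2 * R)) - s))%C in H3 by ring.
  rewrite Cmod_opp in H3.
  assert (H4 : Cmod (a (S n) * RtoC (2 * R) ^ S n)%C <= 2) by lra.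
  rewrite Cmod_mult, Cmod_pow, Cmod_R, Rabs_pos_eq, Rpow_mult_distr in H4 by lra.
  rewrite Cmod_mult, Cmod_pow.
  assert (Hzn : Cmod z ^ S n <= R ^ S n) by (apply pow_incr; split; [apply Cmod_ge_0 | exact Hz]).
  pose proof (Cmod_ge_0 (a (S n))).
  apply Rle_trans with (Cmod (a (S n)) * R ^ S n); [now apply Rmult_le_compat_l|].
  assert (Hpw : 2 ^ S n * (1 / 2) ^ n = 2).
  { simpl; rewrite Rmult_assoc, <- Rpow_mult_distr.
    replace (2 * (1 / 2)) with 1 by field; rewrite pow1; ring. }
  assert (Hh : 0 < (1 / 2) ^ n) by (apply pow_lt; lra).
  apply Rmult_le_reg_l with (2 ^ S n); [apply pow_lt; lra|].
  rewrite Hpw; lra. }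
destruct (pow_lt_1_zero (1 / 2) ltac:(rewrite Rabs_pos_eq; lra) (eps / 2) ltac:(lra)) as [k Hk].
exists (N + k)%nat; intros n z Hn Hz.
specialize (Hk n ltac:(lia)).
rewrite Rabs_pos_eq in Hk by (apply pow_le; lra).
assert (Htail : forall j, Cmod (cpoly a (n + j) z - cpoly a n z)%C <= 2 * (1/2) ^ n - 2 * (1/2) ^ (n + j)).
{ induction j as [|j IH].
  - rewrite Nat.add_0_r; replace (cpoly a n z - cpoly a n z)%C with (RtoC 0) by ring.
    rewrite Cmod_0; lra.
  - rewrite Nat.add_succ_r.
    change (cpoly a (S (n + j)) z) with (cpoly a (n + j) z + a (S (n + j)) * z ^ S (n + j))%C.
    replace (cpoly a (n + j) z + a (S (n + j)) * z ^ S (n + j) - cpoly a n z)%C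
      with ((cpoly a (n + j) z - cpoly a n z) + a (S (n + j)) * z ^ S (n + j))%C by ring.
    eapply Rle_trans; [apply Cmod_triangle|].
    pose proof (Hterm (n + j)%nat z ltac:(lia) Hz).
    change ((1 / 2) ^ S (n + j)) with (1 / 2 * (1 / 2) ^ (n + j)); lra. }
apply Rnot_lt_le; intros Hlt.
destruct (series_fun_lim a z Ha (Cmod (series_fun a z - cpoly a n z)%C - eps) ltac:(lra)) as [N' HN'].
specialize (HN' (n + N')%nat ltac:(lia)); specialize (Htail N').
pose proof (Cmod_triangle (cpoly a (n + N') z - cpoly a n z)
  (- (cpoly a (n + N') z - series_fun a z))) as H.
rewrite Cmod_opp in H.
replace (cpoly a (n + N') z - cpoly a n z + - (cpoly a (n + N') z - series_fun a z))%C
  with (series_fun a z - cpoly a n z)%C in H by ring.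
assert (0 < (1 / 2) ^ (n + N')) by (apply pow_lt; lra).
lra.
Qed.

Lemma series_fun_uniform (a : nat -> C) (R eps : R) : entire_series a -> 0 < R -> 0 < eps ->
  exists n, forall z, Cmod z <= R -> Cmod (series_fun a z - cpoly a n z)%C <= eps.
Proof.
intros Ha HR He; destruct (series_fun_uniform_ge a R eps Ha HR He) as [n Hn].
exists n; intros z; now apply Hn.
Qed.

Lemma series_fun_continuous (a : nat -> C) (p : C) (e : R) : entire_series a -> 0 < e ->
  near0 (fun h => Rabs (Cmod (series_fun a (p + h)%C) - Cmod (series_fun a p)) < e).
Proof.
intros Ha He; pose proof (Cmod_ge_0 p).
destruct (series_fun_uniform a (Cmod p + 1) (e / 4) Ha ltac:(lra) ltac:(lra)) as [n Hn].
assert (H1 : near0 (fun h => Cmod h < 1)) by (exists 1; split; [lra | auto]).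
eapply near0_imp;
  [|exact (near0_and _ _ H1 (jet2_near _ p (e / 4) (jet2_cpoly a n p) ltac:(lra)))].
cbv beta; intros h [Hh Hc].
pose proof (Cmod_triangle p h).
pose proof (Hn (p + h)%C ltac:(lra)) as H3; pose proof (Hn p ltac:(lra)) as H4.
set (u := series_fun a (p + h)%C) in *; set (v := series_fun a p) in *.
set (u' := cpoly a n (p + h)%C) in *; set (v' := cpoly a n p) in *.
assert (Huv : Cmod (u - v) < e).
{ replace (u - v)%C with ((u - u') + (u' - v') + - (v - v'))%C by ring.
  pose proof (Cmod_triangle ((u - u') + (u' - v')) (- (v - v'))).
  pose proof (Cmod_triangle (u - u') (u' - v')).
  rewrite Cmod_opp in *; lra. }
pose proof (Cmod_minus_bound u v) as H5; pose proof (Cmod_minus_bound v u) as H6.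
replace (v - u)%C with (- (u - v))%C in H6 by ring; rewrite Cmod_opp in H6.
apply Rabs_lt_between; lra.
Qed.

(** * Maximum and minimum modulus on circles *)

Lemma circle_attains_max (u : C -> R) (r : R) : 0 <= r ->
  (forall p e, 0 < e -> near0 (fun h => u (p + h)%C < u p + e)) ->
  exists p, Cmod p = r /\ forall q, Cmod q = r -> u q <= u p.
Proof.
intros Hr Hu; apply (attains_max (fun z => Cmod z = r) u r).
- exists (RtoC r); rewrite Cmod_R; now apply Rabs_pos_eq.
- intros p Hp; lra.
- intros p Hp; exists (Rabs (Cmod p - r)); split; [apply Rabs_pos_lt; lra|]; intros h Hh Hph.
  pose proof (Cmod_triangle p h) as H1.
  pose proof (Cmod_minus_bound p (p + h)%C) as H2.
  replace (p - (p + h))%C with (- h)%C in H2 by ring; rewrite Cmod_opp in H2.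
  assert (Rabs (Cmod p - r) <= Cmod h) by (apply Rabs_le; lra); lra.
- intros p _ e He; eapply near0_imp; [|exact (Hu p e He)]; auto.
Qed.

(** The [epsilon] in [max_mod] is meaningful only once a maximum is known to exist; continuity on
    the compact circle provides it. *)
Lemma max_mod_spec (a : nat -> C) (r : R) : entire_series a -> 0 <= r ->
  is_max_mod (series_fun a) r (max_mod (series_fun a) r).
Proof.
intros Ha Hr; apply (epsilon_spec (inhabits 0) (is_max_mod (series_fun a) r)).
destruct (circle_attains_max (fun z => Cmod (series_fun a z)) r Hr) as (p & Hp & Hmax).
- intros p e He; eapply near0_imp; [|exact (series_fun_continuous a p e Ha He)].
  cbv beta; intros h Hh; apply Rabs_lt_between in Hh; lra.
- exists (Cmod (series_fun a p)); split; [now exists p | exact Hmax].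
Qed.

Lemma min_mod_spec (a : nat -> C) (r : R) : entire_series a -> 0 <= r ->
  is_min_mod (series_fun a) r (min_mod (series_fun a) r).
Proof.
intros Ha Hr; apply (epsilon_spec (inhabits 0) (is_min_mod (series_fun a) r)).
destruct (circle_attains_max (fun z => - Cmod (series_fun a z)) r Hr) as (p & Hp & Hmax).
- intros p e He; eapply near0_imp; [|exact (series_fun_continuous a p e Ha He)].
  cbv beta; intros h Hh; apply Rabs_lt_between in Hh; lra.
- exists (Cmod (series_fun a p)); split; [now exists p|].
  intros q Hq; specialize (Hmax q Hq); cbv beta in Hmax.
  change (Cmod (series_fun a p) <= Cmod (series_fun a q)); lra.
Qed.

Lemma max_mod_ge_0 (a : nat -> C) (r : R) : entire_series a -> 0 <= r ->
  0 <= max_mod (series_fun a) r.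
Proof.
intros Ha Hr; destruct (max_mod_spec a r Ha Hr) as [(z & _ & <-) _].
exact (Cmod_ge_0 (series_fun a z)).
Qed.

(** The maximum principle is applied to a Taylor polynomial. An approximation within a third of the
    supposed excess is used once on the circle and once at [z], leaving a third for the
    contradiction. *)
Lemma max_mod_monotone (a : nat -> C) (r R : R) : entire_series a -> 0 <= r <= R -> 0 < R ->
  max_mod (series_fun a) r <= max_mod (series_fun a) R.
Proof.
intros Ha Hr HR.
destruct (max_mod_spec a r Ha ltac:(lra)) as [(z & Hz & <-) _].
destruct (max_mod_spec a R Ha ltac:(lra)) as [_ HM].
pose proof (max_mod_ge_0 a R Ha ltac:(lra)) as HM0.
set (M := max_mod (series_fun a) R) in *.
change (Cmod z = r) in Hz; change (Cmod (series_fun a z) <= M).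
change (forall z, Cmod z = R -> Cmod (series_fun a z) <= M) in HM.
apply Rnot_lt_le; intros Hlt.
destruct (series_fun_uniform a R ((Cmod (series_fun a z) - M) / 3) Ha HR ltac:(lra)) as [n Hn].
assert (H : Cmod (cpoly a n z) <= M + (Cmod (series_fun a z) - M) / 3).
{ apply (disc_maximum (cpoly a n) R); [intros; apply jet2_cpoly | lra | | lra].
  intros w Hw; specialize (HM w Hw); specialize (Hn w ltac:(lra)).
  pose proof (Cmod_minus_bound (cpoly a n w) (series_fun a w)) as H.
  replace (cpoly a n w - series_fun a w)%C with (- (series_fun a w - cpoly a n w))%C in H by ring.
  rewrite Cmod_opp in H; lra. }
specialize (Hn z ltac:(lra)).
pose proof (Cmod_minus_bound (series_fun a z) (cpoly a n z)); lra.
Qed.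

Lemma cpoly_scale (a : nat -> C) (k m : C) (n : nat) (z : C) :
  cpoly (fun i => (a i * k ^ i * m)%C) n z = (cpoly a n (k * z) * m)%C.
Proof.
induction n as [|n IH]; [simpl; ring|].
change (cpoly (fun i => a i * k ^ i * m) n z + a (S n) * k ^ S n * m * z ^ S n
  = (cpoly a n (k * z) + a (S n) * (k * z) ^ S n) * m)%C.
rewrite IH, Cpow_mult_l; ring.
Qed.

Lemma cpoly_split (a : nat -> C) (n k : nat) (z : C) :
  cpoly a (S n + k) z = (cpoly a n z + z ^ S n * cpoly (fun i => a (S n + i)%nat) k z)%C.
Proof.
induction k as [|k IH].
- rewrite Nat.add_0_r; simpl; rewrite Nat.add_0_r; ring.
- rewrite Nat.add_succ_r.
  change (cpoly a (S n + k) z + a (S (S n + k)) * z ^ S (S n + k)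
    = cpoly a n z + z ^ S n * (cpoly (fun i => a (S n + i)%nat) k z + a (S n + S k)%nat * z ^ S k))%C.
  rewrite IH, (Nat.add_succ_r (S n) k).
  replace (S (S n + k)) with (S n + S k)%nat at 2 by lia.
  rewrite Cpow_add_r; ring.
Qed.

Lemma entire_bound (a : nat -> C) (r1 R mu : R) : entire_series a -> 0 < r1 < R ->
  0 < mu < max_mod (series_fun a) R ->
  (forall t, r1 < t < R -> exists z, Cmod z = t /\ Cmod (series_fun a z) <= mu) ->
  max_mod (series_fun a) r1 <=
    max_mod (series_fun a) R
      * exp (ln (mu / max_mod (series_fun a) R) * (1 - 2 * sqrt (r1 / R))).
Proof.
intros Ha Hr Hmu Hmin.
destruct (max_mod_spec a r1 Ha ltac:(lra)) as [(z0 & Hz0 & E0) _].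
destruct (max_mod_spec a R Ha ltac:(lra)) as [_ HM].
rewrite <- E0; clear E0.
set (M := max_mod (series_fun a) R) in *.
change (Cmod z0 = r1) in Hz0.
change (forall z, Cmod z = R -> Cmod (series_fun a z) <= M) in HM.
change (Cmod (series_fun a z0) <= M * exp (ln (mu / M) * (1 - 2 * sqrt (r1 / R)))).
set (th := 1 - 2 * sqrt (r1 / R)).
pose (f := fun x => x + (M + 2 * x) * exp (ln ((mu + x) / (M + 2 * x)) * th)).
replace (M * exp (ln (mu / M) * th)) with (f 0)
  by (unfold f; rewrite Rmult_0_r, Rplus_0_l, !Rplus_0_r; reflexivity).
apply (le_limit_right f _ 1); [| lra |].
{ unfold f; auto_derive; rewrite Rmult_0_r, !Rplus_0_r; repeat split; try lra.
  apply Rdiv_lt_0_compat; lra. }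
intros x Hx; unfold f.
destruct (series_fun_uniform a R x Ha ltac:(lra) ltac:(lra)) as [n Hn].
assert (Hclose : forall z, Cmod z <= R -> Cmod (cpoly a n z) <= Cmod (series_fun a z) + x).
{ intros z Hz; specialize (Hn z Hz).
  pose proof (Cmod_minus_bound (cpoly a n z) (series_fun a z)) as H.
  replace (cpoly a n z - series_fun a z)%C with (- (series_fun a z - cpoly a n z))%C in H by ring.
  rewrite Cmod_opp in H; lra. }
(* On [|z| = R] the Taylor polynomial is at most [M + x]; dividing by [M + 2 x] gives the strict
   bound that [polynomial_bound] requires. *)
pose (D := M + 2 * x); assert (HD : 0 < D) by (unfold D; lra); fold D.
pose (c := fun i => (a i * RtoC R ^ i * RtoC (/ D))%C).
assert (Hc : forall z, Cmod (cpoly c n z) = Cmod (cpoly a n (R * z)%C) / D).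
{ intros z; unfold c; rewrite cpoly_scale, Cmod_mult, Cmod_R, Rabs_pos_eq; [reflexivity|].
  now apply Rlt_le, Rinv_0_lt_compat. }
assert (HRz : forall z, Cmod (R * z)%C = R * Cmod z)
  by (intros z; rewrite Cmod_mult, Cmod_R, Rabs_pos_eq; lra).
assert (HRd : forall z : C, (R * (z / R))%C = z).
{ intros z; field; intros E; injection E; lra. }
assert (Hmd : forall z : C, Cmod (z / R)%C = Cmod z / R).
{ intros z; rewrite Cmod_div, Cmod_R, Rabs_pos_eq; [reflexivity | lra | intros E; injection E; lra]. }
pose proof (polynomial_bound c n (r1 / R) ((mu + x) / D) (z0 / R)%C) as Hb.
rewrite Hc, HRd, Hmd, Hz0 in Hb; fold th in Hb.
assert (Hb' : Cmod (cpoly a n z0) / D <= exp (ln ((mu + x) / D) * th)).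
{ apply Hb; auto.
  - split; [apply Rdiv_lt_0_compat; lra | apply Rlt_div_l; [lra | unfold D; lra]].
  - split; [apply Rdiv_lt_0_compat; lra | apply Rlt_div_l; lra].
  - intros z Hz; rewrite Hc; apply Rlt_div_l; [lra|].
    pose proof (HRz z) as E; rewrite Hz, Rmult_1_r in E.
    specialize (HM _ E); specialize (Hclose _ (Req_le _ _ E)); unfold D; lra.
  - intros t [Ht1 Ht2].
    assert (Ht : r1 < R * t < R).
    { apply Rlt_div_l in Ht1; [|lra]; split; nra. }
    destruct (Hmin _ Ht) as (z & Hz & Hfz).
    exists (z / R)%C; split; [rewrite Hmd, Hz; field; lra|].
    rewrite Hc, HRd; apply Rmult_le_compat_r; [now apply Rlt_le, Rinv_0_lt_compat|].
    specialize (Hclose z ltac:(lra)); lra. }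
apply Rle_div_l in Hb'; [|exact HD].
specialize (Hn z0 ltac:(lra)).
pose proof (Cmod_minus_bound (series_fun a z0) (cpoly a n z0)); lra.
Qed.

(** Let [a (S m)] be the first nonzero coefficient after [a O]. The maximum principle for the
    polynomial quotient [h], whose value at 0 is [a (S m)], gives a Cauchy estimate without
    integrals; the [+ 1] absorbs the truncation error. *)
Lemma max_mod_growth (a : nat -> C) : entire_series a -> transcendental_series a ->
  exists A B, 0 < A /\ forall r, 1 <= r -> A * r - B <= max_mod (series_fun a) r.
Proof.
intros Ha Htr.
assert (Hleast : exists m, a (S m) <> RtoC 0 /\ forall i, (i < m)%nat -> a (S i) = RtoC 0).
{ apply NNPP; intros HN.
  assert (Hall : forall m i, (i < m)%nat -> a (S i) = RtoC 0).
  { induction m as [|m IH]; intros i Hi; [lia|].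
    assert (Hm : a (S m) = RtoC 0) by (apply NNPP; intros Hm; apply HN; now exists m).
    destruct (Nat.eq_dec i m) as [-> | Hne]; [exact Hm | apply IH; lia]. }
  destruct (Htr 1%nat) as ([|i] & Hi & Hne); [lia|].
  apply Hne, (Hall (S i)); lia. }
destruct Hleast as (m & Hm & Hlow).
exists (Cmod (a (S m))), (Cmod (a O) + 1); split; [now apply Cmod_gt_0|]; intros r Hr.
destruct (max_mod_spec a r Ha ltac:(lra)) as [_ HM].
pose proof (max_mod_ge_0 a r Ha ltac:(lra)) as HM0.
set (M := max_mod (series_fun a) r) in *.
change (forall z, Cmod z = r -> Cmod (series_fun a z) <= M) in HM.
destruct (series_fun_uniform_ge a r 1 Ha ltac:(lra) Rlt_0_1) as [n Hn].
specialize (Hn (S m + n)%nat).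
assert (Hconst : forall j z, (j <= m)%nat -> cpoly a j z = a O).
{ intros j z; induction j as [|j IH]; intros Hj; [reflexivity|].
  change (cpoly a j z + a (S j) * z ^ S j = a O)%C.
  rewrite IH, (Hlow j) by lia; ring. }
pose (h := cpoly (fun i => a (S m + i)%nat) n).
assert (Hrm : r <= r ^ S m).
{ simpl; pose proof (pow_R1_Rle r m Hr); nra. }
assert (Hh : Cmod (h (RtoC 0)) <= (M + Cmod (a O) + 1) / r ^ S m).
{ pose proof (Cmod_ge_0 (a O)).
  apply (disc_maximum h r); [intros; apply jet2_cpoly | | | rewrite Cmod_0; lra].
  { apply Rlt_le, Rdiv_lt_0_compat; lra. }
  intros z Hz; apply Rle_div_r; [lra|].
  specialize (HM z Hz); specialize (Hn z ltac:(lia) ltac:(lra)).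
  rewrite cpoly_split, Hconst in Hn by lia; fold h in Hn.
  rewrite <- Hz; rewrite <- Cmod_pow, <- Cmod_mult.
  replace (h z * z ^ S m)%C
    with (series_fun a z + - a O + - (series_fun a z - (a O + z ^ S m * h z)))%C by ring.
  pose proof (Cmod_triangle (series_fun a z + - a O)
    (- (series_fun a z - (a O + z ^ S m * h z)))) as H1.
  pose proof (Cmod_triangle (series_fun a z) (- a O)) as H2.
  rewrite Cmod_opp in H1, H2; lra. }
assert (Hh0 : h (RtoC 0) = a (S m)).
{ unfold h; destruct n as [|n'].
  - simpl; now rewrite Nat.add_0_r.
  - rewrite cpoly_shift, Nat.add_0_r; ring. }
rewrite Hh0 in Hh; apply Rle_div_r in Hh; [|lra].
pose proof (Cmod_ge_0 (a (S m))).
assert (Cmod (a (S m)) * r <= Cmod (a (S m)) * r ^ S m) by (apply Rmult_le_compat_l; lra).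
lra.
Qed.

Theorem theorem3 (a : nat -> Cpx) (Hent : entire_series a) (Htr : transcendental_series a) :
  exists rf : R, 0 < rf /\
    forall r alpha : R, 0 < r -> 0 < alpha < 1/2 ->
      ln (max_mod (series_fun a) r) <= Rpower r alpha ->
      Rpower r (1 - 2 * alpha) >= rf ->
      exists t : R, Rpower r (1 - 2 * alpha) < t < r /\
        0 < min_mod (series_fun a) t /\
        ln (min_mod (series_fun a) t) >
          ln (max_mod (series_fun a) (Rpower r (1 - 2 * alpha))) - 2.
Proof.
destruct (max_mod_growth a Hent Htr) as (A & B & HA & Hgrow).
(* The entry 1 yields [r1 > 1], hence [r > 1] and [r1 < r]; the other yields [M1 > exp 2]. The final
   [+ 1] makes both strict. *)
exists (Rmax 1 ((exp 2 + B) / A) + 1).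
pose proof (Rmax_l 1 ((exp 2 + B) / A)); pose proof (Rmax_r 1 ((exp 2 + B) / A)) as Hrf.
split; [lra|].
intros r alpha Hr Hal Hlog Hr1.
set (r1 := Rpower r (1 - 2 * alpha)) in *.
assert (Hln1 : ln r1 = (1 - 2 * alpha) * ln r) by apply ln_exp.
assert (Hlnr1 : 0 < ln r1) by (rewrite <- ln_1; apply ln_increasing; lra).
assert (Hlnr : 0 < ln r) by (rewrite Hln1 in Hlnr1; nra).
assert (Hr1r : r1 < r) by (apply ln_lt_inv; [lra | lra | nra]).
assert (HM1 : exp 2 < max_mod (series_fun a) r1).
{ apply Rlt_le_trans with (2 := Hgrow r1 ltac:(lra)).
  assert (H1 : (exp 2 + B) / A < r1) by lra.
  apply Rlt_div_l in H1; lra. }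
pose proof (max_mod_monotone a r1 r Hent ltac:(lra) Hr) as Hmono.
apply NNPP; intros HN.
set (M1 := max_mod (series_fun a) r1) in *.
set (M := max_mod (series_fun a) r) in *.
pose proof (exp_pos 2).
pose (mu := M1 * exp (- 2)).
assert (Hmu : 0 < mu) by (apply Rmult_lt_0_compat; [lra | apply exp_pos]).
assert (Hlnmu : ln mu = ln M1 - 2).
{ unfold mu; rewrite ln_mult, ln_exp; [ring | lra | apply exp_pos]. }
assert (HmuM : mu < M).
{ apply Rlt_le_trans with (2 := Hmono); apply ln_lt_inv; lra. }
assert (HlnM1 : 2 < ln M1).
{ rewrite <- (ln_exp 2); now apply ln_increasing. }
pose proof (entire_bound a r1 r mu Hent ltac:(lra) (conj Hmu HmuM)) as Hbound.
fold M1 M in Hbound.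
assert (Hb : M1 <= M * exp (ln (mu / M) * (1 - 2 * sqrt (r1 / r)))).
{ apply Hbound; intros t Ht.
  destruct (min_mod_spec a t Hent ltac:(lra)) as [(z & Hz & Hfz) _].
  exists z; split; [exact Hz|].
  change (Cmod (series_fun a z) = min_mod (series_fun a) t) in Hfz; rewrite Hfz.
  (* A minimum above [mu] is positive, so its logarithm is not the default value 0 of [ln]. *)
  apply Rnot_lt_le; intros Hlt; apply HN; exists t; repeat split; try lra.
  apply Rlt_gt; rewrite <- Hlnmu; now apply ln_increasing. }
assert (Hs : sqrt (r1 / r) = Rpower r (- alpha)).
{ apply Rsqr_inj; [apply sqrt_pos | apply Rlt_le, exp_pos|].
  rewrite Rsqr_sqrt by (apply Rlt_le, Rdiv_lt_0_compat; lra).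
  unfold Rsqr; rewrite <- Rpower_plus; unfold r1.
  rewrite <- (Rpower_1 r Hr) at 2.
  unfold Rdiv; rewrite <- Rpower_Ropp, <- Rpower_plus; f_equal; ring. }
rewrite Hs in Hb.
assert (Hsr : Rpower r (- alpha) * Rpower r alpha = 1).
{ rewrite <- Rpower_plus; replace (- alpha + alpha) with 0 by ring; now apply Rpower_O. }
assert (Hs0 : 0 < Rpower r (- alpha)) by apply exp_pos.
set (s := Rpower r (- alpha)) in *.
assert (Hlnb : ln M1 <= ln M + (ln mu - ln M) * (1 - 2 * s)).
{ rewrite <- ln_div by lra. rewrite <- (ln_exp (ln (mu / M) * (1 - 2 * s))), <- ln_mult;
    [apply ln_le; lra | lra | apply exp_pos]. }
rewrite Hlnmu in Hlnb.
(* [Hlnb] reads [2 <= 2 s (ln M - ln M1 + 2)]. As [ln M1 > 2], the bracket is below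
   [ln M <= r^alpha = 1/s], and [2 < 2] results. *)
assert (s * (ln M - ln M1 + 2) < s * Rpower r alpha) by (apply Rmult_lt_compat_l; lra).
lra.
Qed.
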